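(* Let $\sigma>1$, and for $\tau>0$ let $M_p^{\tau,\sigma}=p^{\tau p^\sigma}$ for $p\in\mathbb N$, $M_0^{\tau,\sigma}=1$, and let $\mathcal M_\sigma=\{(M_p^{\tau,\sigma})_{p\in\mathbb N_0}:\tau>0\}$. Furthermore, let $T_{\tau,\sigma}$ be the associated function to $(M_p^{\tau,\sigma})_{p\in\mathbb N_0}$. Let $\varphi\in C^\infty(\mathbb R^n)$. Then the following conditions are equivalent: 1. $\varphi\in\mathcal S_{(\mathcal M_\sigma)}^{(\mathcal M_\sigma)}(\mathbb R^n)$; 2. $(\forall\tau>0)(\exists C>0)(\forall\alpha,\beta\in\mathbb N_0^n)$ $$\sup_x|x^\alpha\varphi(x)|\le C M^{\tau,\sigma}_{|\alpha|}\quad\text{and}\quad\sup_x|\partial^\beta\varphi(x)|\le C M^{\tau,\sigma}_{|\beta|};$$ 3. $(\forall\tau>0)(\exists C>0)(\forall\alpha,\beta\in\mathbb N_0^n)$ $$\sup_x|x^\alpha\varphi(x)|\le C M^{\tau,\sigma}_{|\alpha|}\quad\text{and}\quad\sup_\xi|\xi^\beta\widehat\varphi(\xi)|\le C M^{\tau,\sigma}_{|\beta|};$$ 4. $(\forall\tau>0)$ $$\sup_x|\varphi(x)|\exp T_{\tau,\sigma}(|x|)<\infty\quad\text{and}\quad\sup_\xi|\widehat\varphi(\xi)|\exp T_{\tau,\sigma}(|\xi|)<\infty.$$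
   Context: For $\varphi\in C^\infty(\mathbb R^n)$: $\varphi\in\mathcal S_{(\mathcal M_\sigma)}^{(\mathcal M_\sigma)}(\mathbb R^n)$ iff $(\forall\tau>0)(\exists C>0)(\forall\alpha,\beta\in\mathbb N_0^n)\ \sup_{x\in\mathbb R^n}|x^\alpha\partial^\beta\varphi(x)|\le C M^{\tau,\sigma}_{|\alpha|}M^{\tau,\sigma}_{|\beta|}$. The associated function is $T_{\tau,\sigma}(r)=\sup_{p\in\mathbb N_0}\ln\frac{r^p}{M_p^{\tau,\sigma}}$ for $r>0$, and $T_{\tau,\sigma}(0)=0$. The Fourier transform is $\widehat\varphi(\xi)=\int_{\mathbb R^n}\varphi(x)e^{-2\pi i x\xi}\,dx$, $\xi\in\mathbb R^n$. In conditions 3 and 4 the first estimate guarantees $\varphi\in L^1(\mathbb R^n)$, so that $\widehat\varphi$ is well defined. Suprema are over $\mathbb R^n$. *)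

(* Defs.v *)
From HB Require Import structures.
From mathcomp Require Import all_boot all_order all_algebra.
From mathcomp Require Import all_classical all_reals all_analysis.
From mathcomp Require Import complex.

Set Implicit Arguments.
Unset Strict Implicit.
Unset Printing Implicit Defensive.

Import Order.TTheory GRing.Theory Num.Theory.
Import numFieldNormedType.Exports.

Local Open Scope classical_set_scope.
Local Open Scope ring_scope.

(* The library has no Lebesgue measure on R^n. It is built here on n-tuples by
   iterating the product measure: the measure in dimension n+1 is the image of
   lebesgue_measure \x (the measure in dimension n) under (t, u) |-> t :: u. *)
Section lebesgue_tcons.
Context {R : realType} (n : nat).
Local Notation mR := (measurableTypeR R).
Variable mu : {sigma_finite_measure set (n.-tuple mR) -> \bar R}.

Definition tcons (p : mR * n.-tuple mR) : n.+1.-tuple mR :=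
  [tuple of p.1 :: p.2].

Lemma measurable_tcons : measurable_fun setT tcons.
Proof. exact: measurable_cons. Qed.

Definition tuncons (t : n.+1.-tuple mR) : mR * n.-tuple mR :=
  (thead t, [tuple of behead t]).

Lemma measurable_tuncons : measurable_fun setT tuncons.
Proof.
apply/measurable_fun_pair; first exact: measurable_tnth.
exact: measurable_behead.
Qed.

Lemma tconsK : cancel tcons tuncons.
Proof.
by move=> [x t]; congr pair; apply/val_inj.
Qed.

Definition lebesgue_tcons : set (n.+1.-tuple mR) -> \bar R :=
  pushforward (lebesgue_measure \x mu)%E tcons.

Let lebesgue_tcons0 : lebesgue_tcons set0 = 0%E.
Proof. by have := measurable_tcons => ?; exact: measure0. Qed.

Let lebesgue_tcons_ge0 A : (0 <= lebesgue_tcons A)%E.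
Proof. by have := measurable_tcons => ?; exact: measure_ge0. Qed.

Let lebesgue_tcons_sigma_additive : semi_sigma_additive lebesgue_tcons.
Proof.
by have := measurable_tcons => ?; exact: measure_semi_sigma_additive.
Qed.

HB.instance Definition _ := isMeasure.Build _ _ _ lebesgue_tcons
  lebesgue_tcons0 lebesgue_tcons_ge0 lebesgue_tcons_sigma_additive.

Let lebesgue_tcons_sigma_finite : sigma_finite setT lebesgue_tcons.
Proof.
have /sigma_finiteP[F [FT ndF Foo]] := sigma_finiteT (@lebesgue_measure R).
have /sigma_finiteP[G [GT ndG Goo]] := sigma_finiteT mu.
exists (fun i => tuncons @^-1` (F i `*` G i)).
  apply/esym; rewrite -subTset => t _.
  have [k _ Fk] : (\bigcup_i F i) (tuncons t).1 by rewrite -FT.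
  have [l _ Gl] : (\bigcup_i G i) (tuncons t).2 by rewrite -GT.
  exists (maxn k l) => //; split.
    by move: Fk; exact/subsetPset/ndF/leq_maxl.
  by move: Gl; exact/subsetPset/ndG/leq_maxr.
move=> i; have [mF Fi] := Foo i; have [mG Gi] := Goo i; split.
  rewrite -[X in measurable X]setTI; apply: measurable_tuncons => //.
  exact: measurableX.
rewrite /lebesgue_tcons /pushforward -comp_preimage.
rewrite (_ : tuncons \o tcons = id); last first.
  by apply/funext => p /=; rewrite tconsK.
rewrite preimage_id product_measure1E// lte_mul_pinfty// ge0_fin_numE.
  by [].
exact: measure_ge0.
Qed.

HB.instance Definition _ := Measure_isSigmaFinite.Build _ _ _ lebesgue_tcons
  lebesgue_tcons_sigma_finite.

End lebesgue_tcons.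

Fixpoint lebesgue_tuple (R : realType) (n : nat) :
    {sigma_finite_measure set (n.-tuple (measurableTypeR R)) -> \bar R} :=
  match n with
  | 0 => \d_([tuple] : 0.-tuple (measurableTypeR R))
  | m.+1 => lebesgue_tcons (lebesgue_tuple R m)
  end.

Section schwartz.
Context {R : realType} (n : nat).
Implicit Types (f : 'rV[R]_n -> R) (phi : 'rV[R]_n -> R[i]).

Definition partial (i : 'I_n) f : 'rV[R]_n -> R := 'D_(delta_mx 0 i) f.

Fixpoint Ck (k : nat) f : Prop :=
  match k with
  | 0 => continuous f
  | m.+1 => continuous f /\
      forall i : 'I_n, (forall x, derivable f x (delta_mx 0 i)) /\
                       Ck m (partial i f)
  end.

(* R[i] carries no normed module structure over R, so complex-valued functions
   are differentiated through their real and imaginary parts. *)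
Definition smooth phi : Prop :=
  forall k, Ck k (fun x => complex.Re (phi x)) /\
            Ck k (fun x => complex.Im (phi x)).

Definition partialC (i : 'I_n) phi : 'rV[R]_n -> R[i] := fun x =>
  Complex (partial i (fun y => complex.Re (phi y)) x)
          (partial i (fun y => complex.Im (phi y)) x).

Definition mabs (alpha : {ffun 'I_n -> nat}) : nat := (\sum_(i < n) alpha i)%N.

Definition mpow (x : 'rV[R]_n) (alpha : {ffun 'I_n -> nat}) : R :=
  \prod_(i < n) x 0 i ^+ alpha i.

(* The order of the partial derivatives is immaterial on C^oo functions. *)
Definition mpartial (beta : {ffun 'I_n -> nat}) phi : 'rV[R]_n -> R[i] :=
  foldr (fun i g => iter (beta i) (partialC i) g) phi (enum 'I_n).

(* The library's norm on 'rV[R]_n is the sup norm, hence the explicit Euclidean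
   norm. *)
Definition enorm (x : 'rV[R]_n) : R := Num.sqrt (\sum_(i < n) x 0 i ^+ 2).

Definition dotp (x y : 'rV[R]_n) : R := \sum_(i < n) x 0 i * y 0 i.

Definition cis (t : R) : R[i] := Complex (cos t) (sin t).

Definition integralRn f : R :=
  \int[lebesgue_tuple R n]_t f (\row_(i < n) tnth t i).

(* The integral is taken over Re and Im separately; it is the actual Fourier
   integral as soon as phi is integrable. *)
Definition fourier phi : 'rV[R]_n -> R[i] := fun xi =>
  let g x := phi x * cis (- 2 * pi * dotp x xi) in
  Complex (integralRn (fun x => complex.Re (g x)))
          (integralRn (fun x => complex.Im (g x))).

Definition sup_norm phi : \bar R :=
  ereal_sup (range (fun x => (ComplexField.Normc.normc (phi x))%:E)).
End schwartz.

Section weights.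
Context {R : realType}.
Implicit Types (tau sigma r : R).

Definition Mseq tau sigma (p : nat) : R :=
  if p == 0%N then 1 else p%:R `^ (tau * p%:R `^ sigma).

(* Extended-real valued, so that no finiteness has to be built into the supremum;
   the second branch is only meaningful at r = 0. *)
Definition assoc_fun tau sigma r : \bar R :=
  if 0 < r then
    ereal_sup (range (fun p : nat => (ln (r ^+ p / Mseq tau sigma p))%:E))
  else 0%E.
End weights.

Definition gelfand_shilov {R : realType} (n : nat) (sigma : R) :
    set ('rV[R]_n -> R[i]) :=
  [set phi | smooth phi /\
    forall tau : R, 0 < tau -> exists2 C : R, 0 < C &
      forall alpha beta : {ffun 'I_n -> nat},
        (sup_norm (fun x => (mpow x alpha)%:C%C * mpartial beta phi x)%R <=
         (C * Mseq tau sigma (mabs alpha) * Mseq tau sigma (mabs beta))%:E)%E].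

(* Main.v *)
Require Import Defs.
From mathcomp Require Import all_boot all_order all_algebra.
From mathcomp Require Import all_classical all_reals all_analysis.
From mathcomp Require Import complex measurable_realfun.
From mathcomp Require Import ring lra zify.

Set Implicit Arguments.
Unset Strict Implicit.
Unset Printing Implicit Defensive.

Import Order.TTheory GRing.Theory Num.Theory.
Import numFieldNormedType.Exports.

Local Open Scope classical_set_scope.
Local Open Scope ring_scope.

(** The four conditions say that a smooth function and its derivatives, or the
    function and its Fourier transform, decay at the rate given by the weights
    [M_p = p ^ (tau p ^ sigma)] for every [tau > 0].  Two features of the weights
    are used throughout.  Passing from [M_p] to [M_(2 p)] only dilates [tau]
    ([Mseq_double]), and because [sigma > 1] any factor of size [p ^ O(p)], such as
    [A ^ p] or [p!], is absorbed by another dilation of [tau] ([Mseq_absorb]).  The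
    complex function is treated through its real and imaginary parts, and decay
    against monomials through powers of a single coordinate, the largest one.

    Separate bounds on [x ^ alpha phi] and on [phi ^ (beta)] imply the joint bound
    on [x ^ alpha phi ^ (beta)] by interpolation ([decay_ipartial]).  Along a ray
    on which the chosen coordinate does not decrease, the derivative of order [k]
    is controlled by the geometric mean of the function and of its derivative of
    order [2 k] ([kolmogorov_interpolation]).  Taking [x ^ (2 alpha) phi] and the
    derivative of order [2 k] as data, the geometric mean turns [M_(2 p)] and
    [M_(2 k)] into the product of [M_p] and [M_k], up to a dilation of [tau].  The
    constant of the interpolation inequality has to grow like [k ^ O(k)], which
    comes from Taylor expansion at [2 k] equidistant nodes.

    The joint bound makes every derivative integrable, and integration by parts
    gives the decay of the Fourier transform ([ctr_decays_of_partials]).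
    Conversely, the decay of the transform bounds the derivatives by Fourier
    inversion ([partials_of_ctr_decays]).  The inversion is used in a regularized
    form: the mean of [u] against a product of one-dimensional Poisson kernels is
    the integral of the transform against the product of the factors
    [expR (- 2 pi e |xi_j|)], by Fubini ([poisson_mean_ctr]), and it tends to [u]
    as [e] tends to [0] ([poisson_approximation]).  An iterated difference of [u]
    with steps [h] is then at most the product of the steps times the integral of
    the transform against the factors [2 pi |xi_j|] ([diffs_le_ctr]), and letting
    the steps tend to [0] gives the bound on the derivative ([phi] is smooth).  Working with differences avoids
    differentiating under the integral sign.

    The weighted sup norms are matched with the associated function by taking the
    supremum over [p] of [r ^ p / M_p] ([assoc_bound_of_decays] and
    [decays_of_assoc_bound]). *)

(** * The weight sequence *)

Section weight_sequence.
Context {R : realType} (sigma : R).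
Implicit Types (tau : R) (p q : nat).

Lemma Mseq0 tau : Mseq tau sigma 0 = 1.
Proof. by []. Qed.

Lemma Mseq_pos tau p : (0 < p)%N ->
  Mseq tau sigma p = p%:R `^ (tau * p%:R `^ sigma).
Proof. by rewrite /Mseq; case: p. Qed.

Lemma Mseq_ge1 tau p : 0 <= tau -> 1 <= Mseq tau sigma p.
Proof.
move=> tau0; case: p => [|p]; first by rewrite Mseq0.
rewrite Mseq_pos// -[leLHS](powRr0 p.+1%:R) ler_powR ?ler1n//.
by rewrite mulr_ge0 ?powR_ge0.
Qed.

Lemma Mseq_gt0 tau p : 0 < Mseq tau sigma p.
Proof. by case: p => [|p]; rewrite ?Mseq0// Mseq_pos// powR_gt0// ltr0n. Qed.

Lemma MseqD tau1 tau2 p :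
  Mseq (tau1 + tau2) sigma p = Mseq tau1 sigma p * Mseq tau2 sigma p.
Proof.
case: p => [|p]; first by rewrite !Mseq0 mulr1.
by rewrite !Mseq_pos// mulrDl powRD// pnatr_eq0/= implybT.
Qed.

Lemma Mseq_half tau p :
  Mseq tau sigma p = Mseq (tau / 2) sigma p * Mseq (tau / 2) sigma p.
Proof. by rewrite -MseqD -splitr. Qed.

Lemma ler_Mseq_tau tau1 tau2 p :
  tau1 <= tau2 -> Mseq tau1 sigma p <= Mseq tau2 sigma p.
Proof.
move=> t12; have -> : tau2 = tau1 + (tau2 - tau1) by lra.
by rewrite MseqD ler_peMr ?(ltW (Mseq_gt0 _ _))// Mseq_ge1// subr_ge0.
Qed.

Hypothesis sigma1 : 1 < sigma.

Let sigma0 : 0 <= sigma.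
Proof. by rewrite (le_trans ler01) ?ltW. Qed.

Lemma ler_Mseq tau p q : 0 <= tau -> (p <= q)%N ->
  Mseq tau sigma p <= Mseq tau sigma q.
Proof.
move=> tau0; case: p => [|p] pq; first by rewrite Mseq0 Mseq_ge1.
rewrite !Mseq_pos ?(leq_trans _ pq)//.
have q1 : 1 <= q%:R :> R by rewrite ler1n (leq_trans _ pq).
apply: (@le_trans _ _ (p.+1%:R `^ (tau * q%:R `^ sigma))).
  rewrite ler_powR ?ler1n// ler_wpM2l// ge0_ler_powR ?nnegrE//.
  by rewrite ler_nat.
by rewrite ge0_ler_powR ?nnegrE ?mulr_ge0 ?powR_ge0// ler_nat.
Qed.

(** Passing from [p] to [2 p] multiplies the exponent [tau p ^ sigma] by
    [2 ^ sigma] and the base by [2 <= p], hence costs only a dilation of [tau],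
    which is harmless when all [tau > 0] are available. *)
Lemma Mseq_double tau : 0 < tau -> exists2 tau', 0 < tau' <= tau &
  exists2 C, 0 < C & forall p, Mseq tau' sigma p.*2 <= C * Mseq tau sigma p.
Proof.
move=> tau0; pose tau' := tau / 2 / 2 `^ sigma.
have s2 : 1 <= 2 `^ sigma :> R.
  by rewrite -[leLHS](powRr0 2) ler_powR// ler1n.
have tau'0 : 0 < tau' by rewrite !divr_gt0 ?(lt_le_trans ltr01 s2).
exists tau'.
  rewrite tau'0/= ler_pdivrMr ?(lt_le_trans ltr01 s2)//.
  apply: (@le_trans _ _ tau); last by rewrite ler_peMr// ltW.
  by rewrite ler_pdivrMr// mulr2n mulrDr mulr1 lerDl ltW.
exists (Mseq tau' sigma 2); first exact: Mseq_gt0.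
move=> p; have [p1|p1] := leqP p 1.
  rewrite (@le_trans _ _ (Mseq tau' sigma 2))//.
    by rewrite ler_Mseq ?ltW//; case: p p1 => [|[|]].
  by rewrite ler_peMr ?(ltW (Mseq_gt0 _ _))// Mseq_ge1// ltW.
rewrite (@le_trans _ _ (Mseq tau sigma p))//; last first.
  by rewrite ler_peMl ?(ltW (Mseq_gt0 _ _))// Mseq_ge1// ltW.
rewrite !Mseq_pos ?double_gt0 ?(ltn_trans _ p1)//.
have -> : tau * p%:R `^ sigma = 2 * (tau' * p.*2%:R `^ sigma).
  rewrite -mul2n natrM powRM// /tau'.
  by field; rewrite gt_eqF// (lt_le_trans ltr01 s2).
rewrite [leRHS]powRrM powR_mulrn// ge0_ler_powR ?nnegrE//.
  by rewrite mulr_ge0 ?powR_ge0// ltW.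
by rewrite -natrX ler_nat -mul2n; nia.
Qed.

(** Since [sigma > 1], the exponent [tau p ^ sigma] eventually exceeds every
    multiple of [p].  In particular all factors of the form [A ^ p], [p! ^ A] or
    [(2 p) ^ (A p)] that appear in the proof are absorbed by the weights. *)
Lemma Mseq_absorb tau (N : nat) : 0 < tau -> exists2 C, 0 < C &
  forall p, (N * p.+1)%:R ^+ (N * p) <= C * Mseq tau sigma p.
Proof.
move=> tau0; pose b : R := (3 * N%:R / tau) `^ (sigma - 1)^-1.
pose p0 := (N + 2 + (Num.truncn b).+1)%N.
pose f p : R := (N * p.+1)%:R ^+ (N * p).
have f0 p : 0 <= f p by rewrite exprn_ge0.
exists (1 + \sum_(p < p0) f p).
  by rewrite ltr_pwDl ?sumr_ge0.
move=> p; have [pp0|pp0] := ltnP p p0.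
  apply: (@le_trans _ _ (1 + \sum_(q < p0) f q)).
    rewrite (bigD1 (Ordinal pp0))//= addrCA lerDl addr_ge0// sumr_ge0//.
  by rewrite ler_peMr ?Mseq_ge1 ?ltW// ltr_pwDl ?sumr_ge0.
apply: (@le_trans _ _ (Mseq tau sigma p)); last first.
  by rewrite ler_peMl ?(ltW (Mseq_gt0 _ _))// lerDl sumr_ge0.
rewrite Mseq_pos; last by rewrite (leq_trans _ pp0)// /p0 !addnS.
have pN : (N + 2 <= p)%N by rewrite (leq_trans _ pp0)// /p0 leq_addr.
apply: (@le_trans _ _ ((p ^ 3)%:R ^+ (N * p))).
  rewrite lerXn2r ?nnegrE// ler_nat expnS -mulnn.
  have : (p.+1 <= p * p)%N by nia.
  by nia.
have p_gt0 : (0 < p)%N by lia.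
rewrite natrX -exprM -powR_mulrn//; apply: ler_powR; first by rewrite ler1n.
have bp : b <= p%:R.
  apply/ltW/(lt_le_trans (truncnS_gt _)); rewrite ler_nat.
  by rewrite (leq_trans _ pp0)// /p0 leq_addl.
have : 3 * N%:R / tau <= p%:R `^ (sigma - 1).
  rewrite (@le_trans _ _ (b `^ (sigma - 1)))//.
    by rewrite /b -powRrM mulVf ?powRr1 ?divr_ge0 ?mulr_ge0 ?(ltW tau0)// subr_eq0 gt_eqF.
  by rewrite ge0_ler_powR ?nnegrE ?powR_ge0// subr_ge0 ltW.
rewrite ler_pdivrMr// => h.
rewrite -(@mulr_powRB1 _ p%:R sigma)//; last by rewrite (lt_trans ltr01).
have := ler_wpM2l (ler0n R p) h.
by rewrite !natrM; lra.
Qed.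

End weight_sequence.

(** * Interpolation of intermediate derivatives *)

Section interpolation.
Context {R : realType}.

Lemma coef_prod_XsubC_le (I : Type) (s : seq I) (P : pred I) (a : I -> R)
    (b : R) (k : nat) :
  (forall i, `|a i| <= b) ->
  `|(\prod_(i <- s | P i) ('X - (a i)%:P))`_k| <= (1 + b) ^+ size s.
Proof.
move=> ab; elim: s k => [|i s IH] k /=.
  by rewrite big_nil expr0 coef1; case: eqP; rewrite ?normr1 ?normr0.
have b0 : 0 <= b by exact: le_trans (ab i).
rewrite big_cons; case: (P i); last first.
  by rewrite (le_trans (IH k))// exprS ler_peMl ?exprn_ge0 ?addr_ge0// lerDl.
rewrite mulrBl coefB coefXM coefCM exprS mulrDl mul1r.
rewrite (le_trans (ler_normB _ _))// lerD ?normrM ?ler_pM//.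
by case: ifP => _; rewrite ?normr0 ?exprn_ge0 ?addr_ge0.
Qed.

(** Numerical differentiation: the weights are the [k]-th coefficients of the
    Lagrange polynomials at the nodes [0, ..., m - 1]; the identity says that the
    formula is exact on monomials of degree less than [m]. *)
Lemma differentiation_weights (m k : nat) : (k < m)%N -> exists c : 'I_m -> R,
  (forall j, `|c j| <= (1 + m%:R) ^+ m) /\
  (forall l, (l < m)%N -> \sum_(j < m) c j * j%:R ^+ l = (l == k)%:R).
Proof.
move=> km; have m0 : (0 < m)%N by exact: leq_ltn_trans km.
pose x (j : nat) : R := j%:R.
have xinj : injective x by move=> i j /eqP; rewrite eqr_nat => /eqP.
pose L := @qpoly.lagrange R m x.
exists (fun j => (tnth L j : {poly R})`_k); split=> [j|l lm].
  rewrite lagrangeE//= coefCM normrM -[leRHS]mul1r ler_pM//; last first.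
    rewrite [leRHS](_ : _ = (1 + m%:R) ^+ size (index_enum 'I_m)).
      by apply: coef_prod_XsubC_le => i; rewrite /x normr_nat ler_nat ltnW.
    by rewrite [index_enum _]unlock -enumT size_enum_ord.
  rewrite normfV horner_prod normr_prod invf_le1; last first.
    rewrite prodr_gt0// => i ij; rewrite normr_gt0 hornerXsubC subr_eq0.
    by rewrite (inj_eq xinj) eq_sym; apply: contraNneq ij => /val_inj ->.
  apply: (@big_ind _ (fun z : R => 1 <= z)) => //; first exact: mulr_ege1.
  move=> i ij; rewrite hornerXsubC /x.
  have -> : j%:R - i%:R = ((j : nat)%:Z - (i : nat)%:Z)%:~R :> R.
    by rewrite intrB.
  by rewrite -intr_norm ler1z -gtz0_ge1 normr_gt0 subr_eq0 eqz_nat eq_sym.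
have := @qpoly.lagrange_gen R m x m0 xinj 'X^l.
rewrite size_polyXn => /(_ lm)/(congr1 (fun p : {poly R} => p`_k)).
rewrite coefXn eq_sym => ->; rewrite coef_sum; apply: eq_bigr => j _.
by rewrite coefCM hornerXn mulrC.
Qed.

(** Mean value induction; the factor [1 / m!] of the sharp remainder is dropped,
    which the final constant [k ^ O(k)] can afford. *)
Lemma taylor_bound (m : nat) (f : nat -> R -> R) (B t : R) : 0 <= t ->
  (forall l (x : R), is_derive x 1 (f l) (f l.+1 x)) ->
  (forall x, 0 <= x -> `|f m x| <= B) ->
  `|f 0 t - \sum_(l < m) f l 0 / l`!%:R * t ^+ l| <= B * t ^+ m.
Proof.
move=> t0; elim: m f t t0 => [|m IH] f t t0 df fB.
  by rewrite big_ord0 subr0 expr0 mulr1 fB.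
pose P n (g : nat -> R -> R) := \poly_(l < n) (g l 0 / l`!%:R).
have PE n g s : (P n g).[s] = \sum_(l < n) g l 0 / l`!%:R * s ^+ l.
  by rewrite horner_poly.
have dP : (P m.+1 f)^`() = P m (fun l => f l.+1).
  apply/polyP => i; rewrite coef_deriv !coef_poly ltnS; case: ifP => // _.
    by rewrite factS natrM -mulrnAr invfM -mulrnAl -[_^-1 *+ _]mulr_natr mulVf ?mul1r ?pnatr_eq0.
  by rewrite mul0rn.
pose g := f 0 - horner (P m.+1 f).
have dg (s : R) : is_derive s 1 g (f 1 s - (P m (fun l => f l.+1)).[s]).
  by rewrite -dP; exact: is_deriveB.
have g0 : g 0 = 0.
  suff : f 0 0 - (P m.+1 f).[0] = 0 by [].
  by rewrite horner_coef0 coef_poly/= fact0 divr1 subrr.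
have gt : g t = f 0 t - \sum_(l < m.+1) f l 0 / l`!%:R * t ^+ l by rewrite -PE.
have [c ct gc] : exists2 c, c \in `[0, t] & g t - g 0 =
    (f 1 c - (P m (fun l => f l.+1)).[c]) * (t - 0).
  apply: MVT_segment => //; apply: derivable_within_continuous => s _.
  exact: ex_derive.
move: ct; rewrite in_itv/= => /andP[c0 ct].
rewrite -gt -[g t]subr0 -[X in `|_ - X|]g0 gc subr0 normrM exprSr mulrA.
rewrite [`|t|]ger0_norm// ler_wpM2r// PE.
have B0 : 0 <= B by exact: le_trans (fB 0 _).
rewrite (le_trans (IH (fun l => f l.+1) c c0 _ _))//.
by rewrite ler_wpM2l// lerXn2r.
Qed.

(** Interpolation between [f] and its derivative of order [2 k] on a half-line:
    the Taylor remainders at the nodes [0, h, ..., (2 k - 1) h] are combined with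
    weights that isolate the term of order [k].  The growth [k ^ O(k)] of the
    constant is what the weight sequence can absorb; iterating the inequality
    between orders [0], [1] and [2] would produce [2 ^ (k ^ 2)]. *)
Lemma kolmogorov_interpolation (k : nat) (f : nat -> R -> R) (A B h : R) :
  0 <= h ->
  (forall l (x : R), is_derive x 1 (f l) (f l.+1 x)) ->
  (forall x, 0 <= x -> `|f 0 x| <= A) ->
  (forall x, 0 <= x -> `|f k.*2 x| <= B) ->
  `|f k 0| * h ^+ k <= (8 * k.+1)%:R ^+ (8 * k) * (A + B * h ^+ k.*2).
Proof.
move=> h0 df fA fB; have [->|k0] := posnP k.
  rewrite !expr0 mul1r !mulr1; rewrite (le_trans (fA 0 _))// lerDl.
  exact: le_trans (fB 0 _).
have A0 : 0 <= A by exact: le_trans (fA 0 _).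
have B0 : 0 <= B by exact: le_trans (fB 0 _).
pose m := k.*2; have km : (k < m)%N by rewrite /m; lia.
have [c [cle cE]] := differentiation_weights km.
have jh0 (j : 'I_m) : 0 <= j%:R * h by rewrite mulr_ge0.
pose T t := \sum_(l < m) f l 0 / l`!%:R * t ^+ l.
have TE : \sum_(j < m) c j * T (j%:R * h) = f k 0 / k`!%:R * h ^+ k.
  under eq_bigr do rewrite /T big_distrr/=.
  rewrite exchange_big/= (bigD1 (Ordinal km))//= [X in _ + X]big1 ?addr0.
    under eq_bigr do rewrite exprMn mulrCA [_ * (_ * h ^+ k)]mulrA.
    by rewrite -big_distrr/= -big_distrl/= cE// eqxx mul1r.
  move=> l lk.
  under eq_bigr do rewrite exprMn mulrCA [_ * (_ * h ^+ l)]mulrA.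
  rewrite -big_distrr/= -big_distrl/= cE//; case: eqP => [lkE|_].
    by case/eqP: lk; exact/val_inj.
  by rewrite mul0r mulr0.
have cT j : `|c j * T (j%:R * h)| <=
    (1 + m%:R) ^+ m * (m%:R ^+ m * (A + B * h ^+ m)).
  rewrite normrM ler_pM//.
  have hT : `|T (j%:R * h)| <= A + B * (j%:R * h) ^+ m.
    have := taylor_bound (jh0 j) df fB; have := fA _ (jh0 j).
    have := lerB_dist (T (j%:R * h)) (f 0 (j%:R * h)).
    by rewrite distrC -/m -/(T _); lra.
  rewrite (le_trans hT)// mulrDr lerD//.
    by rewrite ler_peMl// exprn_ege1// ler1n; lia.
  rewrite mulrCA ler_wpM2l// exprMn ler_wpM2r ?exprn_ge0//.
  by rewrite lerXn2r ?nnegrE// ler_nat ltnW.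
have : `|f k 0 / k`!%:R * h ^+ k| <=
    m%:R * ((1 + m%:R) ^+ m * (m%:R ^+ m * (A + B * h ^+ m))).
  rewrite -TE (le_trans (ler_norm_sum _ _ _))//.
  rewrite (le_trans (ler_sum _ (fun j _ => cT j)))//.
  by rewrite sumr_const card_ord mulr_natl.
rewrite !normrM normfV normr_nat mulrAC ler_pdivrMr ?ltr0n ?fact_gt0//.
rewrite (ger0_norm (exprn_ge0 _ h0)) => /le_trans; apply.
rewrite -/m !mulrA -mulrAC; rewrite ler_wpM2r//.
  by rewrite addr_ge0// mulr_ge0// exprn_ge0.
have -> : (1 : R) + m%:R = (m.+1)%:R by rewrite -natr1 addrC.
rewrite -!natrX -!natrM ler_nat.
have fk : (k`! <= m.+1 ^ k)%N.
  have : (k <= m.+1)%N by lia.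
  elim: (k) => // i hi im; rewrite factS expnS.
  by rewrite leq_mul// hi// ltnW.
have : (m * m.+1 ^ m * m ^ m * k`! <= m.+1 * m.+1 ^ m * m.+1 ^ m * m.+1 ^ k)%N.
  by rewrite !leq_mul// leq_exp2r//; lia.
have -> : (m.+1 * m.+1 ^ m * m.+1 ^ m * m.+1 ^ k = m.+1 ^ (m + m + k).+1)%N.
  by rewrite -expnS -!expnD; congr (_ ^ _)%N; lia.
rewrite mulnAC => /leq_trans; apply.
apply: (@leq_trans ((8 * k.+1) ^ (m + m + k).+1)%N).
  by rewrite leq_exp2r//; rewrite /m; lia.
by rewrite leq_exp2l//; rewrite /m; lia.
Qed.

End interpolation.

(** * Decay of the derivatives *)

Section real_partials.
Context {R : realType} {n : nat}.
Implicit Types (u g : 'rV[R]_n -> R) (s : seq 'I_n) (x : 'rV[R]_n).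

(** Real counterpart of [mpartial], along an arbitrary list of coordinates so
    that the list can be peeled off from the outermost derivative. *)
Definition ipartial s (beta : {ffun 'I_n -> nat}) u : 'rV[R]_n -> R :=
  foldr (fun i g => iter (beta i) (partial i) g) u s.

Definition Cinfty u : Prop := forall k, Ck k u.

Lemma Cinfty_continuous u : Cinfty u -> continuous u.
Proof. by move=> /(_ 0%N). Qed.

Lemma Cinfty_derivable u i x : Cinfty u -> derivable u x (delta_mx 0 i).
Proof. by move=> /(_ 1%N)[_] /(_ i)[]. Qed.

Lemma Cinfty_partial u i : Cinfty u -> Cinfty (partial i u).
Proof. by move=> uoo k; have [_ /(_ i)[]] := uoo k.+1. Qed.

Lemma Cinfty_iter u i k : Cinfty u -> Cinfty (iter k (partial i) u).
Proof. by move=> uoo; elim: k => //= k; exact: Cinfty_partial. Qed.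

Lemma Cinfty_ipartial u s beta : Cinfty u -> Cinfty (ipartial s beta u).
Proof. by move=> uoo; elim: s => //= i s; exact: Cinfty_iter. Qed.

Lemma eq_ipartial u s (beta gamma : {ffun 'I_n -> nat}) :
  {in s, beta =1 gamma} -> ipartial s beta u = ipartial s gamma u.
Proof.
elim: s => //= i s IH bg; rewrite bg ?mem_head// IH// => j js.
by rewrite bg// inE js orbT.
Qed.

Lemma ipartial0 u s (beta : {ffun 'I_n -> nat}) :
  {in s, forall i, beta i = 0%N} -> ipartial s beta u = u.
Proof.
elim: s => //= i s IH b0; rewrite b0 ?mem_head//= IH// => j js.
by rewrite b0// inE js orbT.
Qed.

Lemma ipartial_cat u s1 s2 (beta : {ffun 'I_n -> nat}) :
  ipartial (s1 ++ s2) beta u = ipartial s1 beta (ipartial s2 beta u).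
Proof. exact: foldr_cat. Qed.

Lemma is_derive_line u x v (t : R) : derivable u (x + t *: v) v ->
  is_derive t 1 (fun t => u (x + t *: v)) ('D_v u (x + t *: v)).
Proof.
have E : (fun h : R => h^-1 *: (((fun t => u (x + t *: v)) \o shift t) (h *: 1) -
      u (x + t *: v))) =
    (fun h : R => h^-1 *: ((u \o shift (x + t *: v)) (h *: v) -
      u (x + t *: v))).
  apply/funext => h /=; congr (_ *: (u _ - _)).
  by rewrite [h *: 1]mulr1 scalerDl addrCA.
by move=> du; apply: DeriveDef; rewrite /derivable ?/derive E.
Qed.

Lemma is_derive_partial u i x (t : R) : Cinfty u ->
  is_derive t 1 (fun t => u (x + t *: delta_mx 0 i))
    (partial i u (x + t *: delta_mx 0 i)).
Proof. by move=> uoo; apply: is_derive_line; exact: Cinfty_derivable. Qed.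

Lemma mabs_double (beta gamma : {ffun 'I_n -> nat}) :
  (forall i, (beta i <= (gamma i).*2)%N) -> (mabs beta <= (mabs gamma).*2)%N.
Proof.
move=> bg; rewrite /mabs -mul2n big_distrr/=; apply: leq_sum => i _.
by rewrite mul2n.
Qed.

Lemma leq_mabs (beta gamma : {ffun 'I_n -> nat}) :
  (forall i, (beta i <= gamma i)%N) -> (mabs beta <= mabs gamma)%N.
Proof. by move=> bg; exact: leq_sum. Qed.

Lemma leq_mabs1 (beta : {ffun 'I_n -> nat}) i : (beta i <= mabs beta)%N.
Proof. by rewrite /mabs (bigD1 i)//= leq_addr. Qed.

End real_partials.

Section decay_of_derivatives.
Context {R : realType} {n : nat} (sigma : R) (sigma1 : 1 < sigma).
Variable u : 'rV[R]_n -> R.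
Hypothesis uoo : Cinfty u.
Local Notation M tau := (Mseq tau sigma).

(** The interpolation inequality with the power weights that the two bounds carry:
    a weight [r ^ (2 q)] on [f] alone becomes [r ^ q] on the derivative of
    order [k]. *)
Lemma kolmogorov_weighted (k q : nat) (f : nat -> R -> R) (A B r : R) :
  0 < r ->
  (forall l (t : R), is_derive t 1 (f l) (f l.+1 t)) ->
  (forall t, 0 <= t -> r ^+ q.*2 * `|f 0 t| <= A) ->
  (forall t, 0 <= t -> `|f k.*2 t| <= B) ->
  (0 < k)%N ->
  r ^+ q * `|f k 0| <= (8 * k.+1)%:R ^+ (8 * k) * (A + B).
Proof.
move=> r0 df fA fB k0.
(* the step h is tuned so that h ^ k = r ^ - q *)
pose h := r `^ (- q%:R / k%:R).
have hk : h ^+ k = (r ^+ q)^-1.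
  rewrite -powR_mulrn ?powR_ge0// -powRrM divfK ?pnatr_eq0 -?lt0n//.
  by rewrite powRN powR_mulrn// ltW.
have rq0 : 0 < r ^+ q by rewrite exprn_gt0.
have rq2 : r ^+ q.*2 = r ^+ q * r ^+ q by rewrite -exprD addnn.
have fA' t : 0 <= t -> `|f 0 t| <= A / (r ^+ q * r ^+ q).
  by move=> t0; rewrite ler_pdivlMr ?mulr_gt0// mulrC -rq2 fA.
have := kolmogorov_interpolation (powR_ge0 r (- q%:R / k%:R)) df fA' fB.
rewrite -/h -addnn exprD hk => /(ler_wpM2r (ltW (mulr_gt0 rq0 rq0))).
move: (r ^+ q) rq0 => a a0; rewrite (_ : _ / a * _ = a * `|f k 0|); last first.
  by field; rewrite gt_eqF.
move=> /le_trans; apply; rewrite le_eqVlt; apply/orP; left; apply/eqP.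
by field; rewrite gt_eqF.
Qed.

Lemma outward_ray (x : 'rV[R]_n) (i j : 'I_n) : exists2 e : R, e ^+ 2 = 1 &
  forall t, 0 <= t -> `|x 0 i| <= `|(x + (e * t) *: delta_mx 0 j : 'rV_n) 0 i|.
Proof.
pose e : R := if 0 <= x 0 i then 1 else -1.
exists e; first by rewrite /e; case: ifP; rewrite ?sqrrN expr1n.
move=> t t0; rewrite !mxE eqxx/=; case: eqP => _; last by rewrite mulr0 addr0.
rewrite /e mulr1; case: ifPn => [x0|]; first by rewrite mul1r !ger0_norm ?addr_ge0// lerDl.
by rewrite -ltNge => x0; rewrite mulN1r !ltr0_norm ?lerN2 ?subr_lt0 ?(lt_le_trans x0)//; lra.
Qed.

Hypothesis u_decay : forall tau, 0 < tau -> exists2 C, 0 < C &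
  forall i q (x : 'rV_n), `|x 0 i| ^+ q * `|u x| <= C * M tau q.

Hypothesis u_partial : forall tau, 0 < tau -> exists2 C, 0 < C &
  forall beta (x : 'rV_n), `|ipartial (enum 'I_n) beta u x| <= C * M tau (mabs beta).

Let suffix_partial s1 s2 : enum 'I_n = s1 ++ s2 ->
  forall tau, 0 < tau -> exists2 C, 0 < C &
  forall beta (x : 'rV_n), `|ipartial s2 beta u x| <= C * M tau (mabs beta).
Proof.
move=> s12 tau tau0; have [C C0 hC] := u_partial tau0; exists C => // beta x.
pose gamma := [ffun i => if i \in s2 then beta i else 0%N].
have := hC gamma x; rewrite s12 ipartial_cat ipartial0; last first.
  move=> i i1; rewrite ffunE ifF//; apply/negP => i2.
  have := enum_uniq 'I_n; rewrite s12 cat_uniq => /and3P[_ /hasPn/(_ _ i2)].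
  by rewrite /= i1.
have -> : ipartial s2 gamma u = ipartial s2 beta u.
  by apply: eq_ipartial => i i2; rewrite ffunE i2.
move=> /le_trans; apply; rewrite ler_wpM2l ?(ltW C0)// ler_Mseq// ?ltW//.
by apply: leq_mabs => i; rewrite ffunE; case: ifP.
Qed.

(** The derivatives are peeled off one coordinate at a time.  On the ray issued
    from [x] in the direction [e_j], chosen so that [|x_i|] does not decrease,
    [d_j ^ k g] is interpolated between [g], which decays by induction, and
    [d_j ^ (2 k) g], which is bounded. *)
Lemma decay_ipartial tau : 0 < tau -> exists2 C, 0 < C &
  forall beta i q (x : 'rV_n), `|x 0 i| ^+ q * `|ipartial (enum 'I_n) beta u x| <=
    C * M tau q * M tau (mabs beta).
Proof.
suff H s1 s2 : enum 'I_n = s1 ++ s2 -> forall tau, 0 < tau ->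
    exists2 C, 0 < C & forall beta i q (x : 'rV_n),
    `|x 0 i| ^+ q * `|ipartial s2 beta u x| <= C * M tau q * M tau (mabs beta).
  exact: (H [::]).
elim: s2 s1 => [|j s IH] s1 s1E {}tau tau0.
  have [C C0 hC] := u_decay tau0; exists C => // beta i q x.
  by rewrite (le_trans (hC _ _ _))// ler_peMr ?Mseq_ge1 ?mulr_ge0 ?ltW ?Mseq_gt0.
have tau20 : 0 < tau / 2 by rewrite divr_gt0.
have [tau1 /andP[tau10 tau12] [C1 C10 hC1]] := Mseq_double sigma1 tau20.
have tau1tau : tau1 <= tau by rewrite (le_trans tau12)// ler_pdivrMr//; lra.
have s1E' : enum 'I_n = rcons s1 j ++ s by rewrite cat_rcons.
have [C0 C00 hC0] := IH _ s1E' _ tau10.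
have [C2 C20 hC2] := suffix_partial s1E tau10.
have [C3 C30 hC3] := Mseq_absorb sigma1 8 tau20.
exists (C3 * (C0 * C1 + C2 * C1) + C2 + C0).
  by rewrite !addr_gt0// mulr_gt0// addr_gt0// mulr_gt0.
move=> beta i q x.
have M1 t p : 0 < t -> 1 <= M t p by move=> t0; rewrite Mseq_ge1// ltW.
have M0 t p : 0 <= M t p by rewrite ltW// Mseq_gt0.
have C012 : 0 <= C3 * (C0 * C1 + C2 * C1).
  by rewrite mulr_ge0 ?addr_ge0 ?mulr_ge0// ltW.
have MM : 0 <= M tau q * M tau (mabs beta) by rewrite mulr_ge0.
(* on the hyperplane x_i = 0 only q = 0 gives a non-trivial claim *)
have [r0|r0] := eqVneq (x 0 i) 0.
  rewrite r0 normr0; case: q MM => [|q] MM; last first.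
    by rewrite exprS !mul0r -mulrA mulr_ge0// !addr_ge0 ?(ltW C20) ?(ltW C00).
  rewrite expr0 mul1r Mseq0 mulr1 (le_trans (hC2 _ _))//.
  rewrite ler_pM ?(ltW C20) ?ler_Mseq_tau//.
  by rewrite -addrA addrCA lerDl addr_ge0 ?(ltW C00).
rewrite -normr_gt0 in r0.
set k := beta j; have [k0|k0] := posnP k.
  rewrite [ipartial _ _ _]/(iter k (partial j) (ipartial s beta u)) k0/=.
  rewrite (le_trans (hC0 _ _ _ _))// -!mulrA ler_pM ?mulr_ge0 ?(ltW C00)//.
    by rewrite lerDr addr_ge0 ?(ltW C20).
  by rewrite ler_pM ?ler_Mseq_tau.
pose g := ipartial s beta u.
pose gamma := [ffun l => if l == j then k.*2 else beta l].
have jNs : j \notin s.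
  have := enum_uniq 'I_n; rewrite s1E' cat_uniq => /and3P[_ + _].
  by apply: contra => js; apply/hasP; exists j; rewrite // mem_rcons mem_head.
have gg : ipartial (j :: s) gamma u = iter k.*2 (partial j) g.
  rewrite /= ffunE eqxx /g; congr iter; apply: eq_ipartial => l ls.
  by rewrite ffunE; case: eqP => // lj; rewrite -lj ls in jNs.
have gamma2 : (mabs gamma <= (mabs beta).*2)%N.
  apply: mabs_double => l; rewrite ffunE; case: eqP => [->//|_].
  by rewrite -addnn leq_addr.
have [e e2 he] := outward_ray x i j.
have e1 : `|e| = 1.
  by apply/eqP; rewrite -(@eqrXn2 _ 2)// -normrX e2 normr1 expr1n.
pose f l t := e ^+ l * iter l (partial j) g (x + (e * t) *: delta_mx 0 j).
have df l (t : R) : is_derive t 1 (f l) (f l.+1 t).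
  pose F t := iter l (partial j) g (x + t *: delta_mx 0 j).
  have dF : is_derive (e * t) 1 F
      (iter l.+1 (partial j) g (x + (e * t) *: delta_mx 0 j)).
    by apply: is_derive_partial; exact/Cinfty_iter/Cinfty_ipartial.
  have de : is_derive t 1 (e \*: @id R : R -> R) (e *: 1) by exact: is_deriveZ.
  have dFe := is_derive1_comp dF de.
  have -> : f l = (e ^+ l) \*: (F \o (e \*: @id R)) by [].
  apply: is_derive_eq; rewrite /f exprSr -mulrA; congr (_ * _).
  by rewrite [RHS]mulrC [e *: 1]mulr1.
have fA t : 0 <= t ->
    `|x 0 i| ^+ q.*2 * `|f 0 t| <= C0 * M tau1 q.*2 * M tau1 (mabs beta).
  move=> t0; rewrite /f expr0 mul1r/=.
  apply: le_trans (hC0 beta i q.*2 (x + (e * t) *: delta_mx 0 j)).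
  by rewrite ler_wpM2r// lerXn2r ?nnegrE// he.
have fB t : 0 <= t -> `|f k.*2 t| <= C2 * M tau1 (mabs gamma).
  by move=> t0; rewrite /f normrM normrX e1 expr1n mul1r -gg hC2.
have := kolmogorov_weighted r0 df fA fB k0.
rewrite /f mulr0 scale0r addr0 normrM normrX e1 expr1n mul1r => /le_trans; apply.
have MA : C0 * M tau1 q.*2 * M tau1 (mabs beta) <=
    C0 * C1 * (M tau q * M (tau / 2) (mabs beta)).
  rewrite [leRHS]mulrA ler_pM ?mulr_ge0 ?(ltW C00) ?ler_Mseq_tau//.
  rewrite -mulrA ler_wpM2l ?(ltW C00)// (le_trans (hC1 q))//.
  by rewrite ler_wpM2l ?(ltW C10)// ler_Mseq_tau//; lra.
have MB : C2 * M tau1 (mabs gamma) <=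
    C2 * C1 * (M tau q * M (tau / 2) (mabs beta)).
  rewrite -mulrA ler_wpM2l ?(ltW C20)//.
  rewrite (le_trans (ler_Mseq sigma1 (ltW tau10) gamma2))//.
  by rewrite (le_trans (hC1 _))// ler_wpM2l ?(ltW C10)// ler_peMl// M1.
have MK : (8 * k.+1)%:R ^+ (8 * k) <= C3 * M (tau / 2) (mabs beta).
  rewrite (le_trans (hC3 _))// ler_wpM2l ?(ltW C30)// ler_Mseq ?ltW//.
  exact: leq_mabs1.
apply: (@le_trans _ _ (C3 * (C0 * C1 + C2 * C1) * (M tau q * M tau (mabs beta)))).
  apply: (le_trans (ler_pM _ _ MK (lerD MA MB))).
  - by rewrite exprn_ge0.
  - by rewrite addr_ge0 ?mulr_ge0 ?(ltW C00) ?(ltW C20).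
  - rewrite (Mseq_half sigma tau (mabs beta)) le_eqVlt; apply/orP; left.
    by apply/eqP; ring.
by rewrite -[leRHS]mulrA ler_wpM2r// -addrA lerDl addr_ge0 ?(ltW C00) ?(ltW C20).
Qed.

End decay_of_derivatives.

(** * Integration over the real line *)

Section real_line.
Context {R : realType}.
Local Notation mu := (@lebesgue_measure R).
Implicit Types (g G : R -> R) (t : R).

(** A majorant on the line that is integrable and whose products are the majorant
    used in several variables. *)
Definition oneDsqrV_bounded g : Prop :=
  measurable_fun [set: R] g /\ exists C, forall t, `|g t| <= C * (1 + t ^+ 2)^-1.

Lemma oneDsqr_gt0 t : 0 < 1 + t ^+ 2.
Proof. by rewrite ltr_pwDl// sqr_ge0. Qed.

Lemma continuous_oneDsqrV_fun : continuous (fun t : R => (1 + t ^+ 2)^-1).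
Proof. exact: continuous_oneDsqrV. Qed.

Lemma integral_oneDsqrV : (\int[mu]_t ((1 + t ^+ 2)^-1)%:E = (pi : R)%:E)%E.
Proof.
rewrite ge0_symfun_integralT.
- have := @integral0y_oneDsqr R; rewrite set_itvcy => ->.
  by rewrite -EFinM; congr EFin; lra.
- by move=> t; rewrite invr_ge0 ltW// oneDsqr_gt0.
- exact: continuous_oneDsqrV_fun.
- by move=> t /=; rewrite sqrrN.
Qed.

Lemma integrable_oneDsqrV : mu.-integrable setT (fun t => ((1 + t ^+ 2)^-1)%:E).
Proof.
apply/integrableP; split.
  apply/measurable_EFinP; apply: continuous_measurable_fun.
  exact: continuous_oneDsqrV_fun.
under eq_integral.
  move=> t _; rewrite gee0_abs; last by rewrite lee_fin invr_ge0 ltW// oneDsqr_gt0.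
  over.
by rewrite integral_oneDsqrV ltry.
Qed.

Lemma integrable_oneDsqrV_bounded g : oneDsqrV_bounded g -> mu.-integrable setT (EFin \o g).
Proof.
move=> [mg [C hC]].
apply: (@le_integrable _ _ _ mu setT measurableT _
  (fun t => (C%:E * ((1 + t ^+ 2)^-1)%:E)%E)).
- exact/measurable_EFinP.
- by move=> t _ /=; rewrite lee_fin (le_trans (hC t))// ler_norm.
- by apply: integrableZl => //; exact: integrable_oneDsqrV.
Qed.

Lemma Rintegral_symm_cvg g : mu.-integrable setT (EFin \o g) ->
  (\int[mu]_(x in `[- k%:R, k%:R]) g x)%R @[k --> \oo] --> (\int[mu]_x g x)%R.
Proof.
move=> ig; have mg : measurable_fun setT g.
  by apply/measurable_EFinP; exact: measurable_int ig.
pose D (k : nat) : set R := [set` `[- k%:R, k%:R]].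
have mD k : measurable (D k) by exact: measurable_itv.
pose f_ (k : nat) (x : R) := ((g \_ (D k)) x)%:E.
have : (\int[mu]_x f_ k x)%E @[k --> \oo] --> (\int[mu]_x (g x)%:E)%E.
  have [] // := @dominated_convergence _ _ _ mu setT measurableT f_
    (EFin \o g) (fun x => `|g x|%:E).
  - move=> k; apply/measurable_EFinP; apply/(measurable_restrictT _ _).1.
      exact: mD.
    exact: measurable_funTS.
  - exact/measurable_EFinP.
  - apply: aeW => x _; apply: cvg_near_cst.
    exists (Num.truncn `|x|).+1 => // k /= xk.
    rewrite /f_ patchE mem_set//; rewrite /D/= in_itv/= -ler_norml.
    by rewrite (le_trans (ltW (truncnS_gt _)))// ler_nat.
  - exact: integrable_abse ig.
  - apply: aeW => x k _; rewrite /f_ patchE lee_fin.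
    by case: ifP => //; rewrite normr0.
rewrite -(@fineK _ (\int[mu]_x (g x)%:E)%E) ?integrable_fin_num//.
move=> /fine_cvgP[_]; rewrite /comp /f_.
by under eq_fun do rewrite -/(Rintegral _ _ _) -Rintegral_mkcond.
Qed.

(** Fundamental theorem of calculus on the whole line, with one primitive for
    each half-line, so that integrands with a corner at the origin such as
    [expR (- a * `|t|)] are covered. *)
Lemma Rintegral_FTC g G1 G2 (l : R) :
  continuous g -> oneDsqrV_bounded g ->
  continuous G1 -> continuous G2 ->
  (forall t, 0 < t -> is_derive t 1 G1 (g t)) ->
  (forall t, t < 0 -> is_derive t 1 G2 (g t)) ->
  (G1 k%:R - G1 0 + (G2 0 - G2 (- k%:R))) @[k --> \oo] --> l ->
  (\int[mu]_t g t)%R = l.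
Proof.
move=> cg dg cG1 cG2 dG1 dG2 Gl.
have ig := integrable_oneDsqrV_bounded dg.
have FTC G a b : a < b -> continuous G ->
    {in `]a, b[, forall t, is_derive t 1 G (g t)} ->
    (\int[mu]_(x in `[a, b]) g x)%R = G b - G a.
  move=> ab cG dG; rewrite /Rintegral (@continuous_FTC2 _ g G)//.
  - exact: continuous_subspaceT.
  - split=> [t tab| |]; first by have [] := dG t tab.
    + exact/cvg_at_right_filter/cG.
    + exact/cvg_at_left_filter/cG.
  - by move=> t tab; rewrite derive1E; have [] := dG t tab.
apply/esym/(cvg_unique _ _ (Rintegral_symm_cvg ig)) => //.
apply: cvg_trans Gl; apply: near_eq_cvg; exists 1%N => // k /= k1.
have k0 : 0 < k%:R :> R by rewrite ltr0n.
have := @Rintegral_itvB _ g (BLeft (- k%:R)) (BRight k%:R) 0.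
have isub (A : set R) : measurable A -> mu.-integrable A (EFin \o g).
  by move=> mA; exact: integrableS ig.
move=> /(_ (isub _ (measurable_itv _)))/=.
rewrite !bnd_simp oppr_le0 (ltW k0) => /(_ isT isT)/eqP.
rewrite subr_eq => /eqP ->; rewrite Rintegral_itv_obnd_cbnd; last first.
  by apply: isub; exact: measurable_itv.
rewrite (FTC G1)//; last by move=> t; rewrite in_itv/= => /andP[+ _]; exact: dG1.
rewrite (FTC G2)//; first by rewrite oppr_lt0.
by move=> t; rewrite in_itv/= => /andP[_]; exact: dG2.
Qed.

End real_line.

(** * The Poisson kernel and its Fourier transform *)

Section poisson_kernel.
Context {R : realType}.
Local Notation mu := (@lebesgue_measure R).
Implicit Types (a b e d x t z : R).

(** The kernel [z |-> e / (pi (e ^ 2 + z ^ 2))] of the half-plane at height [e], of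
    total mass [1]. *)
Definition poisson e z : R := e / (pi * (e ^+ 2 + z ^+ 2)).

(** The summation factor whose transform is the Poisson kernel. *)
Definition abel e t : R := expR (- (2 * pi * e * `|t|)).

Lemma sqrD_gt0 e z : 0 < e -> 0 < e ^+ 2 + z ^+ 2.
Proof. by move=> e0; rewrite ltr_pwDl ?exprn_gt0// sqr_ge0. Qed.

Lemma poisson_ge0 e z : 0 < e -> 0 <= poisson e z.
Proof.
by move=> e0; rewrite divr_ge0 ?mulr_ge0 ?pi_ge0 ?(ltW e0)// ltW// sqrD_gt0.
Qed.

Lemma continuous_poisson_shift e x : 0 < e ->
  continuous (fun t => poisson e (x - t)).
Proof.
move=> e0 t; have c : (x - s) @[s --> t] --> x - t.
  by apply: cvgB; [exact: cvg_cst|exact: cvg_id].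
apply: cvgM; first exact: cvg_cst.
apply: cvgV; first by rewrite gt_eqF// mulr_gt0 ?pi_gt0 ?sqrD_gt0.
apply: cvgM; first exact: cvg_cst.
apply: cvgD; first exact: cvg_cst.
by under eq_fun do rewrite expr2; rewrite expr2; exact: cvgM.
Qed.

Lemma poisson_bounded e x : 0 < e ->
  oneDsqrV_bounded (fun t => poisson e (x - t)).
Proof.
move=> e0; split.
  by apply: continuous_measurable_fun; exact: continuous_poisson_shift.
exists (e / pi * (2 + (1 + 2 * x ^+ 2) / e ^+ 2)) => t.
rewrite ger0_norm ?poisson_ge0// /poisson invfM mulrA -[leRHS]mulrA.
rewrite ler_wpM2l ?divr_ge0 ?pi_ge0 ?(ltW e0)//.
have s0 := sqrD_gt0 (x - t) e0; have t0 := oneDsqr_gt0 t.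
rewrite ler_pdivlMr// mulrC ler_pdivrMr//.
have e20 : 0 < e ^+ 2 by rewrite exprn_gt0.
rewrite mulrDl.
apply: (@le_trans _ _ (2 * (x - t) ^+ 2 + (1 + 2 * x ^+ 2))).
  by have := sqr_ge0 (2 * x - t); lra.
apply: lerD; first lra.
rewrite -mulrA -[leLHS]mulr1 ler_wpM2l//; first by have := sqr_ge0 x; lra.
by rewrite mulrC ler_pdivlMr// mul1r lerDl sqr_ge0.
Qed.

Lemma Rintegral_poisson e x : 0 < e -> (\int[mu]_t poisson e (x - t))%R = 1.
Proof.
move=> e0; pose G (t : R) := pi^-1 * atan ((t - x) / e).
have dG (t : R) : is_derive t 1 G (poisson e (x - t)).
  have dl : is_derive t 1 (fun s : R => (s - x) / e) e^-1.
    have -> : (fun s : R => (s - x) / e) = e^-1 \*: (@id R - cst x).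
      by apply/funext => s; rewrite mulrC.
    by apply: is_derive_eq; rewrite subr0 [_ *: _]mulr1.
  have da := @is_derive1_comp _ _ (fun s : R => (s - x) / e) t _ _
    (is_derive1_atan ((t - x) / e)) dl.
  have -> : G = pi^-1 \*: (@atan R \o (fun s : R => (s - x) / e)) by [].
  apply: is_derive_eq; rewrite /poisson.
  transitivity (pi^-1 * ((1 + ((t - x) / e) ^+ 2)^-1 * e^-1)) => //.
  have s0 := sqrD_gt0 (t - x) e0; have p0 := pi_gt0 R.
  have w0 := oneDsqr_gt0 ((t - x) / e).
  rewrite -(sqrrN (x - t)) opprB; move: (t - x) s0 w0 => y s0 w0.
  have -> : e ^+ 2 + y ^+ 2 = e * e * (1 + (y / e) ^+ 2).
    by field; rewrite gt_eqF.
  move: (1 + (y / e) ^+ 2) w0 => w w0.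
  move: (pi : R) p0 => p p0.
  by field; rewrite !gt_eqF.
have cG : continuous G.
  move=> t; apply: differentiable_continuous.
  by apply/derivable1_diffP; have [] := dG t.
apply: (Rintegral_FTC (continuous_poisson_shift e0) (poisson_bounded x e0)
  cG cG).
have lim s : (s == 1) || (s == -1) ->
    G (s * k%:R) @[k --> \oo] --> s * 2^-1.
  move=> s1.
  have -> : s * 2^-1 = pi^-1 * (s * (pi / 2)).
    by move: (pi : R) (pi_gt0 R) => p p0; field; rewrite gt_eqF.
  apply: cvgMl_tmp.
  have E k : atan ((s * k%:R - x) / e) = s * atan ((k%:R - s * x) / e).
    case/orP: s1 => /eqP ->; first by rewrite !mul1r.
    by rewrite !mulN1r -atanN; congr (atan (_)); field; rewrite gt_eqF.
  under eq_fun do rewrite E.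
  apply: cvgMl_tmp.
  apply: (@cvg_comp _ _ _ (fun k : nat => (k%:R - s * x) / e) (@atan R) _ (pinfty_nbhs R)).
    have e10 : 0 < e^-1 by rewrite invr_gt0.
    have c : (r - s * x) / e @[r --> +oo] --> +oo.
      by apply: (gt0_cvgMly e10); exact: cvg_addrr.
    exact: cvg_comp cvgr_idn c.
  exact: cvgy_atan.
have l1 : G (1 * k%:R) @[k --> \oo] --> (1 * 2^-1 : R) by apply: lim; rewrite eqxx.
have l2 : G (-1 * k%:R) @[k --> \oo] --> (-1 * 2^-1 : R).
  by apply: lim; rewrite eqxx orbT.
have lE : 1 * 2^-1 - -1 * 2^-1 = 1 :> R by lra.
suff : (G k%:R - G 0 + (G 0 - G (- k%:R))) @[k --> \oo] -->
    (1 * 2^-1 - -1 * 2^-1 : R) by rewrite lE.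
apply: cvg_trans (cvgB l1 l2); apply: near_eq_cvg; apply: nearW => k.
rewrite subrKA; change (G (1 * k%:R) - G (-1 * k%:R) = G k%:R - G (- k%:R)).
by rewrite mul1r mulN1r.
Qed.

(** The function [z ^ 2 / (z ^ 2 + d ^ 2)] is a smooth substitute for the
    indicator function of [|z| >= d]; partial fractions reduce its integral
    against the kernel to the total mass of two kernels. *)
Lemma Rintegral_poisson_tail e d x : 0 < e -> e < d ->
  (\int[mu]_t ((x - t) ^+ 2 / ((x - t) ^+ 2 + d ^+ 2) * poisson e (x - t)))%R =
  e / (e + d).
Proof.
move=> e0 ed; have d0 : 0 < d by exact: lt_trans ed.
have -> : (fun t => (x - t) ^+ 2 / ((x - t) ^+ 2 + d ^+ 2) * poisson e (x - t)) =
    (fun t => e * d / (d ^+ 2 - e ^+ 2) * poisson d (x - t) -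
              e ^+ 2 / (d ^+ 2 - e ^+ 2) * poisson e (x - t)).
  apply/funext => t; rewrite /poisson.
  move: (x - t) (sqrD_gt0 (x - t) e0) (sqrD_gt0 (x - t) d0) => z ez dz.
  move: (pi : R) (pi_gt0 R) => p p0.
  by field; rewrite !gt_eqF// ?(addrC (z ^+ 2))// subr_gt0 ltrXn2r// ?nnegrE ltW.
have ip c : 0 < c -> mu.-integrable setT (EFin \o (fun t => poisson c (x - t))).
  by move=> c0; exact/integrable_oneDsqrV_bounded/poisson_bounded.
have ipZ c k : 0 < c ->
    mu.-integrable setT (EFin \o (fun t => k * poisson c (x - t))).
  by move=> c0; exact: (integrableZl measurableT k (ip c c0)).
rewrite RintegralB//; [|exact: ipZ|exact: ipZ].
rewrite RintegralZl//; last exact: ip.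
rewrite RintegralZl//; last exact: ip.
rewrite !Rintegral_poisson//.
have de0 : d ^+ 2 - e ^+ 2 != 0.
  by rewrite gt_eqF// subr_gt0 ltrXn2r// ?nnegrE ltW.
have ed0 : e + d != 0 by rewrite gt_eqF// addr_gt0.
by field; rewrite ed0 de0.
Qed.

Lemma abel_gt0 e t : 0 < abel e t.
Proof. exact: expR_gt0. Qed.

Lemma abel_le1 e t : 0 < e -> abel e t <= 1.
Proof.
by move=> e0; rewrite -expR0 ler_expR oppr_le0 !mulr_ge0 ?pi_ge0// ltW.
Qed.

Lemma continuous_abel e : continuous (abel e).
Proof.
move=> t; apply: continuous_comp; last exact: continuous_expR.
apply: cvgN; apply: cvgM; first exact: cvg_cst.
exact: norm_continuous.
Qed.

Lemma abel_bounded e : 0 < e -> oneDsqrV_bounded (abel e).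
Proof.
move=> e0; split; first by apply: continuous_measurable_fun; exact: continuous_abel.
pose a := pi * e; have a0 : 0 < a by rewrite mulr_gt0 ?pi_gt0.
(* 1 + a ^ 2 t ^ 2 <= (1 + a |t|) ^ 2 <= expR (2 a |t|) *)
exists (1 + (a ^+ 2)^-1) => t.
rewrite gtr0_norm ?abel_gt0// ler_pdivlMr ?oneDsqr_gt0//.
rewrite /abel expRN mulrC ler_pdivrMr ?expR_gt0//.
have -> : 2 * pi * e * `|t| = a * `|t| + a * `|t| by rewrite /a; ring.
rewrite expRD.
have h : 1 + a ^+ 2 * t ^+ 2 <= expR (a * `|t|) * expR (a * `|t|).
  have u0 : 0 <= a * `|t| by rewrite mulr_ge0// ltW.
  apply: (@le_trans _ _ ((1 + a * `|t|) * (1 + a * `|t|))).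
    by rewrite -(real_normK (num_real t)); move: u0; lra.
  by rewrite ler_pM ?expR_ge1Dx// addr_ge0.
apply: (@le_trans _ _ ((1 + (a ^+ 2)^-1) * (1 + a ^+ 2 * t ^+ 2))); last first.
  by rewrite ler_wpM2l// addr_ge0// invr_ge0 exprn_ge0// ltW.
rewrite mulrDl mul1r mulrDr mulr1 mulKf ?expf_neq0 ?gt_eqF//.
have : 0 < (a ^+ 2)^-1 by rewrite invr_gt0 exprn_gt0.
have : 0 <= a ^+ 2 * t ^+ 2 by rewrite mulr_ge0 ?sqr_ge0.
by lra.
Qed.

(** The Fourier transform of [abel e] is the Poisson kernel.  The free phase [a]
    makes the cosine and sine transforms a single statement and allows the
    transform in several variables to be computed one variable at a time. *)
Lemma Rintegral_abel_cos e a z : 0 < e ->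
  (\int[mu]_t (abel e t * cos (a + 2 * pi * z * t)))%R = cos a * poisson e z.
Proof.
move=> e0; pose b := 2 * pi * z; pose c := 2 * pi * e.
have c0 : 0 < c by rewrite !mulr_gt0 ?pi_gt0.
pose D := c ^+ 2 + b ^+ 2; have D0 : 0 < D by exact: sqrD_gt0.
(* primitives of the integrand: s = -1 on the positive, s = 1 on the negative
   half-line *)
pose G (s t : R) := expR (s * c * t) *
  (s * c * cos (a + b * t) + b * sin (a + b * t)) / D.
have dL (k m t : R) : is_derive t 1 (fun t : R => k + m * t) m.
  have -> : (fun t : R => k + m * t) = cst k + m \*: @id R by [].
  by apply: is_derive_eq; rewrite add0r [_ *: _]mulr1.
have dG (s t : R) : s ^+ 2 = 1 ->
    is_derive t 1 (G s) (expR (s * c * t) * cos (a + b * t)).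
  move=> s2; pose L t := a + b * t; pose E t := 0 + s * c * t.
  have dE := @is_derive1_comp _ _ E t _ _ (is_derive_expR (E t)) (dL 0 (s * c) t).
  have dC := @is_derive1_comp _ _ L t _ _ (is_derive_cos (L t)) (dL a b t).
  have dS := @is_derive1_comp _ _ L t _ _ (is_derive_sin (L t)) (dL a b t).
  have -> : G s = D^-1 \*: ((@expR R \o E) *
      ((s * c) \*: (@cos R \o L) + b \*: (@sin R \o L))).
    by apply/funext => r; rewrite /G mulrC /E -(add0r (s * c * r)).
  apply: is_derive_eq.
  transitivity (D^-1 * (expR (E t) * (s * c * (- sin (L t) * b) + b * (cos (L t) * b)) +
    (s * c * cos (L t) + b * sin (L t)) * (expR (E t) * (s * c)))) => //.
  rewrite /E add0r -/(L t); move: (expR _) (cos _) (sin _) => X Y Z.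
  transitivity (D^-1 * (X * Y * (s ^+ 2 * c ^+ 2 + b ^+ 2))); first by ring.
  by rewrite s2 mul1r -/D mulrCA mulVf ?mulr1// gt_eqF.
have cG s : s ^+ 2 = 1 -> continuous (G s).
  move=> s2 t; apply: differentiable_continuous.
  by apply/derivable1_diffP; have [] := dG s t s2.
have Glim (s : R) : s ^+ 2 = 1 -> G s (- s * k%:R) @[k --> \oo] --> 0.
  move=> s2; have s1 : `|s| = 1.
    by apply/eqP; rewrite -(@eqrXn2 _ 2)// -normrX s2 normr1 expr1n.
  have Gb (t : R) : `|G s t| <= (c + `|b|) / D * expR (s * c * t).
    rewrite /G normrM (normrM (expR _)) normfV (gtr0_norm D0) ger0_norm ?expR_ge0//.
    rewrite [leRHS]mulrC [leRHS]mulrA ler_wpM2r ?invr_ge0 ?(ltW D0)//.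
    rewrite ler_wpM2l ?expR_ge0// (le_trans (ler_normD _ _))// lerD//.
      by rewrite normrM (normrM s c) s1 mul1r (gtr0_norm c0) ler_piMr ?(ltW c0)// cos_max.
    by rewrite (normrM b) ler_piMr// sin_max.
  apply/cvgr0Pnorm_le => eps eps0.
  have cvE : (c + `|b|) / D * expR (- (c * k%:R)) @[k --> \oo] --> (0 : R).
    rewrite -(mulr0 ((c + `|b|) / D)); apply: cvgMl_tmp.
    apply: (@cvg_comp _ _ _ (fun k : nat => c * k%:R) (fun r => expR (- r)) _
      (pinfty_nbhs R)); last exact: cvgr_expR.
    by apply: (cvg_comp _ _ cvgr_idn); exact: gt0_cvgMry.
  move/cvgr0Pnorm_le : cvE => /(_ _ eps0); apply: filterS => k.
  apply: le_trans; apply: le_trans (Gb _) (le_trans _ (ler_norm _)).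
  rewrite (_ : s * c * (- s * k%:R) = - (s ^+ 2 * (c * k%:R))); last by ring.
  by rewrite s2 mul1r.
have s1 : (1 : R) ^+ 2 = 1 by rewrite expr1n.
have sN1 : (-1 : R) ^+ 2 = 1 by rewrite sqrrN expr1n.
have cg : continuous (fun t => abel e t * cos (a + b * t)).
  move=> t; apply: cvgM; first exact: continuous_abel.
  apply: (@continuous_comp _ _ _ (fun t => a + b * t) (@cos R)).
    apply: cvgD; first exact: cvg_cst.
    by apply: cvgM; [exact: cvg_cst|exact: cvg_id].
  exact: continuous_cos.
have bg : oneDsqrV_bounded (fun t => abel e t * cos (a + b * t)).
  split; first exact: continuous_measurable_fun.
  have [_ [C hC]] := abel_bounded e0; exists C => t.
  by rewrite normrM (le_trans _ (hC t))// ler_piMr// cos_max.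
have dG1 (t : R) : 0 < t ->
    is_derive t 1 (G (-1)) (abel e t * cos (a + b * t)).
  move=> t0; have := dG (-1) t sN1.
  by rewrite /abel (gtr0_norm t0) mulN1r mulNr.
have dG2 (t : R) : t < 0 -> is_derive t 1 (G 1) (abel e t * cos (a + b * t)).
  move=> t0; have := dG 1 t s1.
  by rewrite /abel (ltr0_norm t0) mul1r mulrN opprK.
apply: (Rintegral_FTC cg bg (cG _ sN1) (cG _ s1) dG1 dG2).
have l1 : G (-1) k%:R @[k --> \oo] --> 0.
  by have := Glim _ sN1; under eq_fun do rewrite opprK mul1r.
have l2 : G 1 (- k%:R) @[k --> \oo] --> 0.
  by have := Glim _ s1; under eq_fun do rewrite mulN1r.
have -> : cos a * poisson e z = 0 - G (-1) 0 + (G 1 0 - 0).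
  rewrite sub0r subr0 /G !mulr0 expR0 !addr0 !mul1r !mulN1r.
  rewrite /poisson /D /b /c.
  move: (pi : R) (pi_gt0 R) (sqrD_gt0 z e0) => p p0 ez.
  have -> : (2 * p * e) ^+ 2 + (2 * p * z) ^+ 2 = 4 * p * p * (e ^+ 2 + z ^+ 2).
    by ring.
  move: (cos a) (sin a) (_ + _) ez => X Y W W0.
  by field; rewrite !gt_eqF.
apply: cvgD; first by apply: cvgB => //; exact: cvg_cst.
by apply: cvgB => //; exact: cvg_cst.
Qed.

End poisson_kernel.

(** * Fubini's theorem for dominated kernels *)

Section fubini_dominated.
Context d1 d2 (T1 : measurableType d1) (T2 : measurableType d2) {R : realType}.
Variables (m1 : {sigma_finite_measure set T1 -> \bar R}).
Variables (m2 : {sigma_finite_measure set T2 -> \bar R}).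
Variables (K : T1 * T2 -> R) (w1 : T1 -> R) (w2 : T2 -> R).
Hypothesis mK : measurable_fun setT K.
Hypothesis iw1 : m1.-integrable setT (EFin \o w1).
Hypothesis iw2 : m2.-integrable setT (EFin \o w2).
Hypothesis Kw : forall x y, `|K (x, y)| <= w1 x * w2 y.

Lemma integrable_section1 x : m2.-integrable setT (EFin \o (fun y => K (x, y))).
Proof.
apply: (@le_integrable _ _ _ m2 setT measurableT _
  (fun y => ((w1 x)%:E * (w2 y)%:E)%E)).
- by apply/measurable_EFinP; exact: measurable_fun_pair2.
- by move=> y _ /=; rewrite lee_fin (le_trans (Kw x y))// ler_norm.
- by apply: integrableZl.
Qed.

Lemma integrable_section2 y : m1.-integrable setT (EFin \o (fun x => K (x, y))).
Proof.
apply: (@le_integrable _ _ _ m1 setT measurableT _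
  (fun x => ((w2 y)%:E * (w1 x)%:E)%E)).
- by apply/measurable_EFinP; exact: measurable_fun_pair1.
- by move=> x _ /=; rewrite lee_fin (le_trans (Kw x y))// mulrC ler_norm.
- by apply: integrableZl.
Qed.

Lemma integrable_product : (m1 \x m2)%E.-integrable setT (EFin \o K).
Proof.
apply/integrable12ltyP; first exact/measurable_EFinP.
have mw2 : measurable_fun setT (fun y => `|w2 y|%:E).
  by apply/measurable_EFinP/measurableT_comp => //; apply/measurable_EFinP;
    exact: measurable_int iw2.
have mw1 : measurable_fun setT (fun x => `|w1 x|%:E).
  by apply/measurable_EFinP/measurableT_comp => //; apply/measurable_EFinP;
    exact: measurable_int iw1.
have mabs : measurable_fun setT (fun z => `|(EFin \o K) z|%E).
  by apply: measurableT_comp => //; exact/measurable_EFinP.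
apply: (@le_lt_trans _ _ (\int[m1]_x (`|w1 x|%:E * \int[m2]_y `|w2 y|%:E))%E).
  apply: ge0_le_integral => //.
  - by move=> x _; exact: integral_ge0.
  - by apply: (measurable_fun_fubini_tonelli_F (abse \o (EFin \o K))) => //=.
  - by under eq_fun do rewrite muleC; exact: measurable_funeM.
  - move=> x _; rewrite -ge0_integralZl//.
    apply: ge0_le_integral => //.
    + exact: (measurable_fun_pair2 _ mabs).
    + exact: measurable_funeM.
    + by move=> y _ /=; rewrite lee_fin -normrM (le_trans (Kw x y))// ler_norm.
rewrite ge0_integralZr//; last exact: integral_ge0.
have fin1 : (\int[m1]_x `|w1 x|%:E < +oo)%E by have /integrableP[] := iw1.
have fin2 : (\int[m2]_y `|w2 y|%:E < +oo)%E by have /integrableP[] := iw2.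
rewrite lte_mul_pinfty// ?integral_ge0//.
by rewrite ge0_fin_numE ?integral_ge0.
Qed.

Let FE x : (\int[m2]_y (K (x, y))%:E)%E = (\int[m2]_y K (x, y))%:E%R.
Proof.
by rewrite /Rintegral fineK// integrable_fin_num//; exact: integrable_section1.
Qed.

Let GE y : (\int[m1]_x (K (x, y))%:E)%E = (\int[m1]_x K (x, y))%:E%R.
Proof.
by rewrite /Rintegral fineK// integrable_fin_num//; exact: integrable_section2.
Qed.

(** A majorant in product form makes every section integrable, not only almost
    every one, so the iterated integrals are genuine real-valued integrals. *)
Lemma Rintegral_product1 :
  \int[(m1 \x m2)%E]_z K z = \int[m1]_x (\int[m2]_y K (x, y)).
Proof.
rewrite /Rintegral; congr fine; rewrite -integral12_prod_meas1//.
  by apply: eq_integral => x _; rewrite /fubini_F FE.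
exact: integrable_product.
Qed.

Lemma Rintegral_product2 :
  \int[(m1 \x m2)%E]_z K z = \int[m2]_y (\int[m1]_x K (x, y)).
Proof.
rewrite /Rintegral; congr fine; rewrite -integral21_prod_meas1//.
  by apply: eq_integral => y _; rewrite /fubini_G GE.
exact: integrable_product.
Qed.

End fubini_dominated.

(** * Continuous functions are measurable on tuples *)

Section continuous_measurable.
Context {R : realType} {n : nat}.
Local Notation mR := (measurableTypeR R).
Implicit Types (f : 'rV[R]_n -> R) (t : n.-tuple mR).

Definition row_of_tuple t : 'rV[R]_n := \row_i tnth t i.

Lemma continuous_coord f (x : 'rV[R]_n) (eps : R) : continuous f -> 0 < eps ->
  exists2 d : R, 0 < d & forall y : 'rV[R]_n,
    (forall i, `|x 0 i - y 0 i| < d) -> `|f x - f y| < eps.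
Proof.
move=> cf eps0; have /cvgrPdist_lt/(_ _ eps0)/nbhs_ballP[d /= d0 hd] := cf x.
exists d => // y xy; apply: hd; split => // i j.
by rewrite (ord1 i); exact: xy.
Qed.

(** The Borel sets of ['rV_n] and the product sigma-algebra on tuples are
    matched by approximating [f] with functions that only depend on the integer
    parts of the rescaled coordinates and hence take countably many values. *)
Lemma measurable_row_of_tuple f : continuous f ->
  measurable_fun setT (f \o row_of_tuple).
Proof.
move=> cf.
pose z (k : nat) (t : n.-tuple mR) : n.-tuple int :=
  [tuple Num.floor (k.+1%:R * tnth t i) | i < n].
pose v (k : nat) (w : n.-tuple int) : 'rV[R]_n :=
  \row_i ((tnth w i)%:~R / k.+1%:R).
apply: (@measurable_fun_cvg _ _ _ setT (fun k t => f (v k (z k t)))).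
  move=> k _ Y mY; rewrite setTI.
  have -> : (fun t => f (v k (z k t))) @^-1` Y = \bigcup_(w : n.-tuple int)
      (if `[< Y (f (v k w)) >] then [set t | z k t = w] else set0).
    apply/seteqP; split=> t /=.
      by move=> Yt; exists (z k t) => //; case: asboolP.
    by move=> [w _]; case: asboolP => //= Yw zw; rewrite zw.
  apply: countable_bigcupT_measurable; first exact: countableP.
  move=> w; case: asboolP => // _.
  have -> : [set t | z k t = w] = \bigcap_(i in [set: 'I_n])
      ((@tnth n mR)^~ i @^-1` [set x | Num.floor (k.+1%:R * x) = tnth w i]).
    apply/seteqP; split=> t /=.
      by move=> <- i _ /=; rewrite tnth_mktuple.
    by move=> h; apply: eq_from_tnth => i; rewrite tnth_mktuple; exact: h.
  apply: fin_bigcap_measurable => // i _.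
  rewrite -[X in measurable X]setTI; apply: measurable_tnth => //.
  have -> : [set x : R | Num.floor (k.+1%:R * x) = tnth w i] =
      [set` `[(tnth w i)%:~R / k.+1%:R, (tnth w i + 1)%:~R / k.+1%:R[].
    apply/seteqP; split=> x /=; rewrite in_itv/=.
      move=> <-; rewrite ler_pdivrMr ?ltr_pdivlMr// !(mulrC x).
      by rewrite floor_le ?floorD1_gt.
    rewrite ler_pdivrMr ?ltr_pdivlMr// !(mulrC x) => h.
    exact: floor_def.
  exact: measurable_itv.
move=> t _; apply/cvgrPdist_lt => eps eps0.
have [d d0 hd] := continuous_coord (row_of_tuple t) cf eps0.
exists (Num.truncn d^-1) => // k /= kd; apply: hd => i; rewrite !mxE tnth_mktuple.
have k0 : 0 < k.+1%:R :> R by rewrite ltr0n.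
have dk : 1 < d * k.+1%:R.
  rewrite -ltr_pdivrMl// mulr1 (lt_le_trans (truncnS_gt _))// ler_nat.
  by rewrite ltnS.
have f1 := floor_le (k.+1%:R * tnth t i).
have f2 := floorD1_gt (k.+1%:R * tnth t i).
rewrite intrD1 in f2.
move: (Num.floor _) f1 f2 => m f1 f2.
rewrite -(ltr_pM2r k0) -[X in _ * X < _](gtr0_norm k0) -normrM mulrBl divfK ?gt_eqF//.
by rewrite ltr_norml; apply/andP; split; lra.
Qed.

End continuous_measurable.

(** * Integration over tuples *)

Section tuple_integral.
Context {R : realType}.
Local Notation mR := (measurableTypeR R).
Local Notation mu := (@lebesgue_measure R).
Local Notation L n := (lebesgue_tuple R n).

Section tcons.
Context {n : nat}.
Variables (F : n.+1.-tuple mR -> R) (w1 : mR -> R) (w2 : n.-tuple mR -> R).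
Hypothesis mF : measurable_fun setT F.
Hypothesis iw1 : mu.-integrable setT (EFin \o w1).
Hypothesis iw2 : (L n).-integrable setT (EFin \o w2).
Hypothesis Fw : forall x u, `|F (tcons (x, u))| <= w1 x * w2 u.

Let mFt : measurable_fun setT (F \o @tcons R n).
Proof. by apply: measurableT_comp => //; exact: measurable_tcons. Qed.

Let iFt : (mu \x L n)%E.-integrable setT (EFin \o (F \o @tcons R n)).
Proof. exact: (integrable_product mFt iw1 iw2 Fw). Qed.

Lemma integrable_tcons : (L n.+1).-integrable setT (EFin \o F).
Proof.
apply: (@integrable_pushforward _ _ _ _ _ _ (@measurable_tcons R n)
  (mu \x L n)%E) => //; first exact/measurable_EFinP.
Qed.

Let RE : \int[L n.+1]_t F t = \int[(mu \x L n)%E]_z F (tcons z).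
Proof.
rewrite /Rintegral; congr fine.
rewrite [LHS](@integral_pushforward _ _ _ _ _ _ (@measurable_tcons R n)
  (mu \x L n)%E _ (EFin \o F))//.
exact/measurable_EFinP.
Qed.

Lemma Rintegral_tcons1 :
  \int[L n.+1]_t F t = \int[mu]_x (\int[L n]_u F (tcons (x, u))).
Proof. by rewrite RE (Rintegral_product1 mFt iw1 iw2 Fw). Qed.

Lemma Rintegral_tcons2 :
  \int[L n.+1]_t F t = \int[L n]_u (\int[mu]_x F (tcons (x, u))).
Proof. by rewrite RE (Rintegral_product2 mFt iw1 iw2 Fw). Qed.

End tcons.

Lemma tnth_tcons0 n x (u : n.-tuple mR) : tnth (tcons (x, u)) ord0 = x.
Proof. by []. Qed.

Lemma tnth_tconsS n x (u : n.-tuple mR) i :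
  tnth (tcons (x, u)) (lift ord0 i) = tnth u i.
Proof. by rewrite tnthS. Qed.

Lemma integrable_tuple0 (F : 0.-tuple mR -> R) : (L 0).-integrable setT (EFin \o F).
Proof.
have mF : measurable_fun setT F.
  rewrite (_ : F = cst (F [tuple])); first exact: measurable_cst.
  by apply/funext => t /=; rewrite (tuple0 t).
apply/integrableP; split; first exact/measurable_EFinP.
rewrite integral_dirac//; first by rewrite diracT mul1e ltry.
by apply: measurableT_comp => //; exact/measurable_EFinP.
Qed.

Lemma Rintegral_tuple0 (F : 0.-tuple mR -> R) : \int[L 0]_t F t = F [tuple].
Proof.
rewrite /Rintegral integral_dirac//; first by rewrite diracT mul1e.
by have := @measurable_int _ _ _ _ _ _ (integrable_tuple0 F).
Qed.

Lemma measurable_prod_tnth n (g : 'I_n -> R -> R) :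
  (forall i, measurable_fun setT (g i)) ->
  measurable_fun setT (fun t : n.-tuple mR => \prod_(i < n) g i (tnth t i)).
Proof.
move=> mg; apply: measurable_prod => i _.
by apply: (measurableT_comp (mg i)); exact: measurable_tnth.
Qed.

Lemma integral_prod_tnth n (g : 'I_n -> R -> R) :
  (forall i, mu.-integrable setT (EFin \o g i)) ->
  (L n).-integrable setT (EFin \o (fun t => \prod_(i < n) g i (tnth t i))) /\
  \int[L n]_t (\prod_(i < n) g i (tnth t i)) = \prod_(i < n) \int[mu]_x g i x.
Proof.
elim: n g => [|n IH] g ig.
  by split; [exact: integrable_tuple0|rewrite Rintegral_tuple0 !big_ord0].
pose h (i : 'I_n) := g (lift ord0 i).
have [ih hE] := IH h (fun i => ig _).
pose F (t : n.+1.-tuple mR) := \prod_(i < n.+1) g i (tnth t i).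
pose H (u : n.-tuple mR) := \prod_(i < n) h i (tnth u i).
have FE x u : F (tcons (x, u)) = g ord0 x * H u.
  rewrite /F big_ord_recl tnth_tcons0; congr (_ * _).
  by apply: eq_bigr => i _; rewrite tnth_tconsS.
have mF : measurable_fun setT F.
  apply: measurable_prod_tnth => i.
  by apply/measurable_EFinP; exact: measurable_int (ig i).
have i1 : mu.-integrable setT (EFin \o (Num.norm \o g ord0)).
  exact: integrable_norm.
have i2 : (L n).-integrable setT (EFin \o (Num.norm \o H)) by exact: integrable_norm.
have Fw x u : `|F (tcons (x, u))| <= (Num.norm \o g ord0) x * (Num.norm \o H) u.
  by rewrite FE normrM.
split; first exact: (integrable_tcons mF i1 i2 Fw).
rewrite (Rintegral_tcons1 mF i1 i2 Fw) big_ord_recl -hE.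
rewrite -RintegralZr//; apply: eq_Rintegral => x _.
by under eq_Rintegral do rewrite FE; rewrite RintegralZl.
Qed.

(** Being a product, this majorant is inherited by the sections of a function. *)
Definition wt {n} (t : n.-tuple mR) : R := \prod_(i < n) (1 + tnth t i ^+ 2)^-1.

Definition dominated {n} (F : n.-tuple mR -> R) : Prop :=
  measurable_fun setT F /\ exists C, forall t, `|F t| <= C * wt t.

Lemma wt_gt0 n (t : n.-tuple mR) : 0 < wt t.
Proof. by apply: prodr_gt0 => i _; rewrite invr_gt0 oneDsqr_gt0. Qed.

Lemma wt_tcons n x (u : n.-tuple mR) : wt (tcons (x, u)) = (1 + x ^+ 2)^-1 * wt u.
Proof.
rewrite /wt big_ord_recl tnth_tcons0; congr (_ * _).
by apply: eq_bigr => i _; rewrite tnth_tconsS.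
Qed.

Lemma integrable_wt n : (L n).-integrable setT (EFin \o wt).
Proof.
by have [] := @integral_prod_tnth n (fun _ x => (1 + x ^+ 2)^-1)
  (fun=> integrable_oneDsqrV).
Qed.

Lemma Rintegral_wt n : \int[L n]_t wt t = pi ^+ n.
Proof.
have [_ ->] := @integral_prod_tnth n (fun _ x => (1 + x ^+ 2)^-1)
  (fun=> integrable_oneDsqrV).
by rewrite prodr_const card_ord /Rintegral integral_oneDsqrV.
Qed.

Lemma dominated_integrable n (F : n.-tuple mR -> R) :
  dominated F -> (L n).-integrable setT (EFin \o F).
Proof.
move=> [mF [C hC]].
apply: (@le_integrable _ _ _ (L n) setT measurableT _
  (fun t => (C%:E * (wt t)%:E)%E)).
- exact/measurable_EFinP.
- by move=> t _ /=; rewrite lee_fin (le_trans (hC t))// ler_norm.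
- by apply: integrableZl => //; exact: integrable_wt.
Qed.

Lemma Rintegral_le_wt n (F : n.-tuple mR -> R) C : measurable_fun setT F ->
  (forall t, `|F t| <= C * wt t) -> `|\int[L n]_t F t| <= C * pi ^+ n.
Proof.
move=> mF hC; have iF : (L n).-integrable setT (EFin \o F).
  by apply: dominated_integrable; split => //; exists C.
rewrite (le_trans (le_normr_Rintegral _ _))// -Rintegral_wt -RintegralZl//.
  apply: le_Rintegral => //; first exact: integrable_norm.
  exact: (integrableZl measurableT C (integrable_wt n)).
exact: integrable_wt.
Qed.

Lemma dominated_le n (F G : n.-tuple mR -> R) C : measurable_fun setT F ->
  dominated G -> (forall t, `|F t| <= C * `|G t|) -> 0 <= C -> dominated F.
Proof.
move=> mF [_ [B hB]] hC C0; split => //; exists (C * B) => t.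
by rewrite (le_trans (hC t))// -mulrA ler_wpM2l.
Qed.

Lemma dominatedM n (F G : n.-tuple mR -> R) C : dominated F ->
  measurable_fun setT G -> (forall t, `|G t| <= C) ->
  dominated (fun t => F t * G t).
Proof.
move=> dF mG hG; have mF := dF.1.
have C0 : 0 <= C by apply: le_trans (hG (nseq_tuple n 0)).
apply: (@dominated_le n _ F C) => //; first exact: measurable_funM.
by move=> t; rewrite normrM mulrC ler_wpM2r.
Qed.

Lemma dominatedD n (F G : n.-tuple mR -> R) : dominated F -> dominated G ->
  dominated (fun t => F t + G t).
Proof.
move=> [mF [B hB]] [mG [C hC]]; split; first exact: measurable_funD.
exists (B + C) => t.
by rewrite (le_trans (ler_normD _ _))// mulrDl lerD.
Qed.

Lemma dominatedZ n (F : n.-tuple mR -> R) k : dominated F ->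
  dominated (fun t => k * F t).
Proof.
move=> [mF [B hB]]; split; first exact: measurable_funM.
by exists (`|k| * B) => t; rewrite normrM -mulrA ler_wpM2l.
Qed.

Section dominated_tcons.
Context {n : nat} (F : n.+1.-tuple mR -> R).
Hypothesis dF : dominated F.

Let Fw : exists C, 0 <= C /\
  forall x u, `|F (tcons (x, u))| <= C * (1 + x ^+ 2)^-1 * wt u.
Proof.
have [_ [C hC]] := dF; exists C; split => [|x u].
  have := le_trans (normr_ge0 _) (hC (nseq_tuple _ 0)).
  by rewrite pmulr_lge0// wt_gt0.
by rewrite -mulrA -wt_tcons.
Qed.

Let iw C : mu.-integrable setT (EFin \o (fun x : R => C * (1 + x ^+ 2)^-1)).
Proof. exact: (integrableZl measurableT C integrable_oneDsqrV). Qed.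

Lemma dominated_Rintegral1 :
  \int[L n.+1]_t F t = \int[mu]_x (\int[L n]_u F (tcons (x, u))).
Proof.
by have [C [_ hC]] := Fw; exact: (Rintegral_tcons1 dF.1 (iw C) (integrable_wt n)).
Qed.

Lemma dominated_Rintegral2 :
  \int[L n.+1]_t F t = \int[L n]_u (\int[mu]_x F (tcons (x, u))).
Proof.
by have [C [_ hC]] := Fw; exact: (Rintegral_tcons2 dF.1 (iw C) (integrable_wt n)).
Qed.

Lemma dominated_section1 x : dominated (fun u => F (tcons (x, u))).
Proof.
split.
  apply: (measurableT_comp dF.1).
  by apply: (measurableT_comp (@measurable_tcons R n)); exact: pair1_measurable.
by have [C [_ hC]] := Fw; exists (C * (1 + x ^+ 2)^-1).
Qed.

Lemma oneDsqrV_bounded_section2 u : oneDsqrV_bounded (fun x => F (tcons (x, u))).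
Proof.
split.
  apply: (measurableT_comp dF.1).
  by apply: (measurableT_comp (@measurable_tcons R n)); exact: pair2_measurable.
have [C [_ hC]] := Fw; exists (C * wt u) => x.
by rewrite mulrAC.
Qed.

End dominated_tcons.

End tuple_integral.

(** * Iterated differences and trigonometry *)

Section differences.
Context {R : realType} {n : nat}.
Implicit Types (f g : 'rV[R]_n -> R) (x : 'rV[R]_n) (L : seq ('I_n * R)).

Definition shift_diff (j : 'I_n) (h : R) f : 'rV[R]_n -> R :=
  fun x => f (x + h *: delta_mx 0 j) - f x.

Definition diffs L f : 'rV[R]_n -> R :=
  foldr (fun jh g => shift_diff jh.1 jh.2 g) f L.

Lemma is_derive_shift_diff f df (j : 'I_n) (h : R) v :
  (forall x, is_derive x v f (df x)) ->
  forall x, is_derive x v (shift_diff j h f) (shift_diff j h df x).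
Proof.
move=> fdf x; apply: is_deriveB.
have [D E] := fdf (x + h *: delta_mx 0 j).
have qE : (fun k : R => k^-1 *:
      (((fun y => f (y + h *: delta_mx 0 j)) \o shift x) (k *: v) -
       f (x + h *: delta_mx 0 j))) =
    (fun k : R => k^-1 *: ((f \o shift (x + h *: delta_mx 0 j)) (k *: v) -
       f (x + h *: delta_mx 0 j))).
  by apply/funext => k /=; rewrite addrA.
by apply: DeriveDef; rewrite /derivable /derive qE.
Qed.

Lemma is_derive_diffs f df L v : (forall x, is_derive x v f (df x)) ->
  forall x, is_derive x v (diffs L f) (diffs L df x).
Proof. by move=> fdf; elim: L => //= jh L; exact: is_derive_shift_diff. Qed.

Lemma le_derive_of_diff f df (j : 'I_n) (B : R) x :
  is_derive x (delta_mx 0 j) f df ->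
  (forall h, 0 < h -> `|shift_diff j h f x| <= B * h) -> `|df| <= B.
Proof.
move=> [D E] hB; apply/ler_addgt0Pr => e e0.
have /cvgrPdist_le/(_ _ e0) : (fun h => h^-1 *:
    ((f \o shift x) (h *: delta_mx 0 j) - f x)) @ 0^' --> df by rewrite -E.
move=> /nbhs_ballP[d /= d0 /(_ (d / 2))].
have d20 : 0 < d / 2 by rewrite divr_gt0.
rewrite /ball/= sub0r normrN gtr0_norm// => /(_ _ _)/wrap[].
  by rewrite ltr_pdivrMr// ltr_pMr// ltr1n.
  by rewrite gt_eqF.
have := hB _ d20; rewrite /shift_diff => hd.
set q := _ *: _ => hq.
have : `|q| <= B.
  rewrite /q normrM normfV (gtr0_norm d20) mulrC.
  by rewrite ler_pdivrMr// [_ *: _ + x]addrC.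
by have := ler_normD (df - q) q; rewrite subrK; move: hq; lra.
Qed.

(** A bound on all iterated differences, uniform in the steps, passes to the
    iterated derivative: let the steps tend to [0] one at a time. *)
Lemma le_iter_partial_of_diffs (J : seq 'I_n) f (B : R) : Cinfty f ->
  (forall hs : seq R, size hs = size J -> all (fun h => 0 < h) hs ->
     forall x, `|diffs (zip J hs) f x| <= B * \prod_(h <- hs) h) ->
  forall x, `|foldl (fun g j => partial j g) f J x| <= B.
Proof.
elim: J f => [|j J IH] f foo hB x /=.
  by have := hB [::] erefl isT x; rewrite big_nil mulr1.
apply: IH => [|hs hsJ hs0 y]; first exact: Cinfty_partial.
have df y' : is_derive y' (delta_mx 0 j) f (partial j f y').
  by apply: derivableP; exact: Cinfty_derivable.
apply: (le_derive_of_diff (is_derive_diffs (zip J hs) df y)) => h h0.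
have := hB (h :: hs) _ _ y; rewrite /= hsJ h0 hs0 => /(_ erefl isT).
by rewrite big_cons mulrCA mulrC [_ * h]mulrC.
Qed.

Lemma diffs_cvg (T : Type) (F : set_system T) {FF : ProperFilter F}
    (f_ : T -> 'rV[R]_n -> R) f L :
  (forall x, f_ k x @[k --> F] --> f x) ->
  forall x, diffs L (f_ k) x @[k --> F] --> diffs L f x.
Proof. by move=> f_f; elim: L => //= jh L IH x; apply: cvgB; exact: IH. Qed.

Lemma diffs_Rintegral d (T : measurableType d) (m : {measure set T -> \bar R})
    (G : T -> 'rV[R]_n -> R) L :
  (forall x, m.-integrable setT (EFin \o (G ^~ x))) ->
  (forall x, m.-integrable setT (EFin \o (fun t => diffs L (G t) x))) /\
  (forall x, diffs L (fun y => \int[m]_t G t y) x = \int[m]_t diffs L (G t) x).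
Proof.
move=> iG; elim: L => //= jh L [iL EL]; split=> x.
  exact: (integrableB measurableT (iL _) (iL x)).
by rewrite /shift_diff !EL -RintegralB.
Qed.

End differences.

Section trigonometry.
Context {R : realType}.

Lemma ler_norm_sin (s : R) : `|sin s| <= `|s|.
Proof.
wlog s0 : s / 0 <= s.
  move=> H; have [|/ltW s0] := leP 0 s; first exact: H.
  by rewrite -normrN -sinN -[leRHS]normrN H// oppr_ge0.
have [c _] : exists2 c, c \in `[0, s] & sin s - sin 0 = cos c * (s - 0).
  by apply: MVT_segment => //; exact/continuous_subspaceT/continuous_sin.
by rewrite sin0 !subr0 => ->; rewrite normrM ler_piMl// cos_max.
Qed.

Lemma cosDpihalf (s : R) : cos (s + pi / 2) = - sin s.
Proof. by rewrite cosD cos_pihalf sin_pihalf mulr0 sub0r mulr1. Qed.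

Lemma cosBpihalf (s : R) : cos (s - pi / 2) = sin s.
Proof. by rewrite cosB cos_pihalf sin_pihalf mulr0 add0r mulr1. Qed.

Lemma cos_diff (a s : R) :
  cos (a + s *+ 2) - cos a = 2 * sin s * cos (a + s + pi / 2).
Proof.
rewrite cosDpihalf; have {2}-> : a = (a + s) - s by rewrite addrK.
have -> : a + s *+ 2 = (a + s) + s by rewrite mulr2n addrA.
by rewrite cosD cosB; ring.
Qed.

End trigonometry.

(** * The trigonometric transform and integration by parts *)

Section partial_integration.
Context {R : realType}.
Local Notation mR := (measurableTypeR R).
Local Notation mu := (@lebesgue_measure R).
Local Notation L n := (lebesgue_tuple R n).

Definition tuple_upd n (t : n.-tuple mR) (i : 'I_n) (s : R) : n.-tuple mR :=
  [tuple if j == i then s else tnth t j | j < n].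

Lemma tuple_upd0 n (u : n.-tuple mR) (x s : R) :
  tuple_upd (tcons (x, u)) ord0 s = tcons (s, u).
Proof.
apply: eq_from_tnth => j; rewrite tnth_mktuple.
have [k|] := unliftP ord0 j => -> //.
by rewrite !tnth_tconsS.
Qed.

Lemma tuple_updS n (u : n.-tuple mR) (x s : R) i :
  tuple_upd (tcons (x, u)) (lift ord0 i) s = tcons (x, tuple_upd u i s).
Proof.
apply: eq_from_tnth => j; rewrite tnth_mktuple.
have [k|] := unliftP ord0 j => -> //.
by rewrite !tnth_tconsS tnth_mktuple (inj_eq lift_inj).
Qed.

Lemma oneDsqrV_cvg0 (G : R -> R) (C s : R) : s ^+ 2 = 1 ->
  (forall t, `|G t| <= C * (1 + t ^+ 2)^-1) -> G (s * k%:R) @[k --> \oo] --> 0.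
Proof.
move=> s2 GC; apply/cvgr0Pnorm_le => e e0.
have C0 : 0 <= C.
  by have := le_trans (normr_ge0 _) (GC 0); rewrite pmulr_lge0// invr_gt0 oneDsqr_gt0.
exists (Num.truncn (C / e)).+1 => // k /= kC; apply: le_trans (GC _) _.
rewrite exprMn s2 mul1r ler_pdivrMr ?oneDsqr_gt0// -ler_pdivrMl// mulrC.
rewrite (le_trans (ltW (truncnS_gt _)))// (@le_trans _ _ k%:R) ?ler_nat//.
have [->|k0] := posnP k; first by rewrite addr_ge0// sqr_ge0.
rewrite (@le_trans _ _ (k%:R ^+ 2)) ?lerDr//.
by rewrite -natrX ler_nat expnS expn1 leq_pmulr.
Qed.

(** The integral of a partial derivative vanishes: integrate first in the
    variable that is differentiated. *)
Lemma Rintegral_partial_eq0 n (F F' : n.-tuple mR -> R) (i : 'I_n) :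
  dominated F -> dominated F' ->
  (forall t s, is_derive (s : R) 1 (fun s => F (tuple_upd t i s)) (F' (tuple_upd t i s))) ->
  (forall t, continuous (fun s => F' (tuple_upd t i s))) ->
  \int[L n]_t F' t = 0.
Proof.
elim: n F F' i => [|n IH] F F' i dF dF' FF' cF'; first by case: i {FF' cF'}.
move: i FF' cF' => i; have [j|] := unliftP ord0 i => -> FF' cF'.
  rewrite (dominated_Rintegral1 dF').
  rewrite (_ : (fun x => _) = cst 0) ?Rintegral_cst ?mul0r//.
  apply/funext => x.
  have E (H : n.+1.-tuple mR -> R) u :
      (fun s => H (tuple_upd (tcons (x, u)) (lift ord0 j) s)) =
      (fun s => H (tcons (x, tuple_upd u j s))) :> (R -> R).
    by apply/funext => s; rewrite tuple_updS.
  apply: (IH (fun u => F (tcons (x, u))) (fun u => F' (tcons (x, u))) j).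
  - exact: dominated_section1.
  - exact: dominated_section1.
  - by move=> u s; have := FF' (tcons (x, u)) s; rewrite E tuple_updS.
  - by move=> u; have := cF' (tcons (x, u)); rewrite E.
rewrite (dominated_Rintegral2 dF').
rewrite (_ : (fun u => _) = cst 0) ?Rintegral_cst ?mul0r//.
apply/funext => u; pose G s := F (tcons (s, u)).
have E H : (fun s => H (tuple_upd (tcons (0, u)) ord0 s)) =
    (fun s => H (tcons (s, u))) :> (R -> R).
  by apply/funext => s; rewrite tuple_upd0.
have dG (s : R) : is_derive s 1 G (F' (tcons (s, u))).
  by have := FF' (tcons (0, u)) s; rewrite E tuple_upd0.
have cG : continuous G.
  move=> s; apply: differentiable_continuous.
  by apply/derivable1_diffP; have [] := dG s.
have cg : continuous (fun s => F' (tcons (s, u))).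
  by have := cF' (tcons (0, u)); rewrite E.
have [_ [C hC]] := oneDsqrV_bounded_section2 dF u.
apply: (Rintegral_FTC cg (oneDsqrV_bounded_section2 dF' u) cG cG (fun t _ => dG t)
  (fun t _ => dG t)).
have s1 : (1 : R) ^+ 2 = 1 by rewrite expr1n.
have sN1 : (-1 : R) ^+ 2 = 1 by rewrite sqrrN expr1n.
have l1 := oneDsqrV_cvg0 s1 hC; have l2 := oneDsqrV_cvg0 sN1 hC.
suff : (G k%:R - G 0 + (G 0 - G (- k%:R))) @[k --> \oo] --> (0 - 0 : R).
  by rewrite subr0.
apply: cvg_trans (cvgB l1 l2); apply: near_eq_cvg; apply: nearW => k.
change (G (1 * k%:R) - G (-1 * k%:R) = G k%:R - G 0 + (G 0 - G (- k%:R))).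
by rewrite subrKA mul1r mulN1r.
Qed.

End partial_integration.

Section trigonometric_transform.
Context {R : realType} {n : nat}.
Local Notation mR := (measurableTypeR R).
Local Notation L := (lebesgue_tuple R n).
Implicit Types (u : 'rV[R]_n -> R) (x xi : 'rV[R]_n) (a : R).

Definition wrow x : R := \prod_(i < n) (1 + x 0 i ^+ 2)^-1.

Lemma wrow_gt0 x : 0 < wrow x.
Proof. by apply: prodr_gt0 => i _; rewrite invr_gt0 oneDsqr_gt0. Qed.

Lemma wrowE (t : n.-tuple mR) : wrow (row_of_tuple t) = wt t.
Proof. by apply: eq_bigr => i _; rewrite mxE. Qed.

Definition wdominated u : Prop :=
  continuous u /\ exists C, forall x, `|u x| <= C * wrow x.

Lemma wdominated_dominated u : wdominated u -> dominated (u \o row_of_tuple).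
Proof.
move=> [cu [C hC]]; split; first exact: measurable_row_of_tuple.
by exists C => t /=; rewrite -wrowE.
Qed.

(** Cosine transform with a phase; the phases [0] and [- pi / 2] give the cosine
    and the sine transform, and varying the phase keeps differentiation and
    translation within one family of integrals. *)
Definition ctr u a xi : R :=
  integralRn (fun x => u x * cos (a + 2 * pi * dotp x xi)).

Lemma measurable_dotp xi :
  measurable_fun setT (fun t : n.-tuple mR => dotp (row_of_tuple t) xi).
Proof.
apply: measurable_sum => i; apply: measurable_funM => //.
under eq_fun do rewrite mxE.
exact: measurable_tnth.
Qed.

Lemma measurable_cos_dotp a xi : measurable_fun setT
  (fun t : n.-tuple mR => cos (a + 2 * pi * dotp (row_of_tuple t) xi)).
Proof.
apply: (measurableT_comp (continuous_measurable_fun (@continuous_cos R))).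
apply: measurable_funD => //; apply: measurable_funM => //.
exact: measurable_dotp.
Qed.

Lemma dominated_ctr u a xi : wdominated u ->
  dominated (fun t => u (row_of_tuple t) * cos (a + 2 * pi * dotp (row_of_tuple t) xi)).
Proof.
move=> du; apply: (dominatedM (wdominated_dominated du) (C := 1)).
  exact: measurable_cos_dotp.
by move=> t; exact: cos_max.
Qed.

Lemma ctr_bound u a xi C : continuous u -> (forall x, `|u x| <= C * wrow x) ->
  `|ctr u a xi| <= C * pi ^+ n.
Proof.
move=> cu hC; have du : wdominated u by split=> //; exists C.
apply: Rintegral_le_wt; first exact: (dominated_ctr a xi du).1.
by move=> t; rewrite normrM -wrowE (le_trans _ (hC _))// ler_piMr// cos_max.
Qed.

Lemma ctr_phase u a xi : wdominated u ->
  ctr u a xi = cos a * ctr u 0 xi - sin a * ctr u (- (pi / 2)) xi.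
Proof.
move=> du.
have iC b := dominated_integrable (dominated_ctr b xi du).
have iZ k b : L.-integrable setT (EFin \o (fun t => k *
    (u (row_of_tuple t) * cos (b + 2 * pi * dotp (row_of_tuple t) xi)))).
  exact: (integrableZl measurableT k (iC b)).
rewrite /ctr /integralRn -!RintegralZl//.
rewrite -RintegralB//.
apply: eq_Rintegral => t _; rewrite -/(row_of_tuple t) add0r cosD.
by rewrite [- _ + _]addrC cosBpihalf; ring.
Qed.

Lemma ctr_le u a xi : wdominated u ->
  `|ctr u a xi| <= `|ctr u 0 xi| + `|ctr u (- (pi / 2)) xi|.
Proof.
move=> du; rewrite ctr_phase// (le_trans (ler_normB _ _))//.
by rewrite lerD// normrM ler_piMl// ?cos_max ?sin_max.
Qed.

Lemma ctr_diff u a s xi : wdominated u ->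
  ctr u (a + s *+ 2) xi - ctr u a xi = 2 * sin s * ctr u (a + s + pi / 2) xi.
Proof.
move=> du; have iC b := dominated_integrable (dominated_ctr b xi du).
rewrite /ctr /integralRn -RintegralB//.
rewrite -RintegralZl//.
apply: eq_Rintegral => t _; rewrite -/(row_of_tuple t) -mulrBr addrAC.
rewrite cos_diff mulrCA; congr (_ * (_ * cos _)).
by rewrite (addrAC a _ s) (addrAC (a + s) _ (pi / 2)).
Qed.

Lemma ctrN u a xi : ctr u a (- xi) = ctr u (- a) xi.
Proof.
rewrite /ctr /integralRn; apply: eq_Rintegral => t _; rewrite -cosN opprD.
have -> : dotp (\row_i tnth t i) (- xi) = - dotp (\row_i tnth t i) xi.
  by rewrite /dotp -sumrN; apply: eq_bigr => i _; rewrite !mxE mulrN.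
by rewrite mulrN opprK.
Qed.

Lemma dotp_line x xi i (s : R) :
  dotp (x + s *: delta_mx 0 i) xi = dotp x xi + xi 0 i * s.
Proof.
rewrite /dotp (eq_bigr (fun j => x 0 j * xi 0 j +
  (j == i)%:R * (xi 0 i * s))); last first.
  move=> j _; rewrite !mxE eqxx/=; case: eqP => [->|_].
    by rewrite mulr1 mul1r mulrDl [s * _]mulrC.
  by rewrite mulr0 addr0 mul0r addr0.
rewrite big_split/=; congr (_ + _); rewrite (bigD1 i)//= eqxx mul1r.
by rewrite big1 ?addr0// => j /negbTE ->; rewrite mul0r.
Qed.

(** Integration by parts; the derivative of the cosine is again a cosine, with
    shifted phase. *)
Lemma ctr_partial u i a xi : Cinfty u -> wdominated u ->
  wdominated (partial i u) ->
  ctr (partial i u) a xi = 2 * pi * xi 0 i * ctr u (a - pi / 2) xi.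
Proof.
move=> uoo du dpu.
pose C b (t : n.-tuple mR) := cos (b + 2 * pi * dotp (row_of_tuple t) xi).
pose F t := u (row_of_tuple t) * C a t.
pose K := 2 * pi * xi 0 i.
pose F' t := partial i u (row_of_tuple t) * C a t -
  K * (u (row_of_tuple t) * C (a - pi / 2) t).
have dF' : dominated F'.
  apply: dominatedD; first exact: dominated_ctr.
  rewrite (_ : (fun t => _) = (fun t => - K * (u (row_of_tuple t) *
    C (a - pi / 2) t))); last by apply/funext => t; rewrite mulNr.
  by apply: dominatedZ; exact: dominated_ctr.
have updE t (s : R) : row_of_tuple (tuple_upd t i s) =
    row_of_tuple (tuple_upd t i 0) + s *: delta_mx 0 i.
  apply/rowP => j; rewrite !mxE !tnth_mktuple eqxx/=.
  by case: eqP => _; rewrite ?mulr1 ?mulr0 ?add0r ?addr0.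
have CE b t (s : R) : C b (tuple_upd t i s) =
    cos (b + 2 * pi * dotp (row_of_tuple (tuple_upd t i 0)) xi + K * s).
  by rewrite /C updE dotp_line mulrDr addrA /K -!mulrA.
have : \int[L]_t F' t = 0.
  apply: (@Rintegral_partial_eq0 _ _ F F' i) => //; first exact: dominated_ctr.
    move=> t s; pose x := row_of_tuple (tuple_upd t i 0).
    pose b := a + 2 * pi * dotp x xi; pose l (s : R) := b + K * s.
    have dl : is_derive s 1 l K.
      have -> : l = cst b + K \*: @id R by [].
      by apply: is_derive_eq; rewrite add0r [_ *: _]mulr1.
    have dC := @is_derive1_comp _ _ l s _ _ (is_derive_cos (l s)) dl.
    have du' := is_derive_partial i x s uoo.
    have -> : (fun s : R => F (tuple_upd t i s)) =
        (fun s : R => u (x + s *: delta_mx 0 i)) * (@cos R \o l).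
      by apply/funext => r; rewrite /F CE updE.
    apply: is_derive_eq; rewrite /F' !CE -updE /=.
    transitivity (u (row_of_tuple (tuple_upd t i s)) * (- sin (l s) * K) +
      cos (l s) * partial i u (row_of_tuple (tuple_upd t i s))) => //.
    have -> : a - pi / 2 + 2 * pi * dotp (row_of_tuple (tuple_upd t i 0)) xi + K * s =
        l s - pi / 2 by rewrite /l /b; ring.
    by rewrite cosBpihalf -/(l s); ring.
  move=> t; pose x := row_of_tuple (tuple_upd t i 0).
  have cline (g : 'rV[R]_n -> R) : continuous g ->
      continuous (fun s : R => g (x + s *: delta_mx 0 i)).
    move=> cg s; apply: (@continuous_comp _ _ _ (fun s : R => x + s *: delta_mx 0 i) g).
      apply: cvgD; first exact: cvg_cst.
      by apply: cvgZr_tmp; exact: cvg_id.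
    exact: cg.
  have ccos b : continuous (fun s : R => cos (b + K * s)).
    move=> s; apply: (@continuous_comp _ _ _ (fun s : R => b + K * s) (@cos R)).
      apply: cvgD; first exact: cvg_cst.
      by apply: cvgM; [exact: cvg_cst|exact: cvg_id].
    exact: continuous_cos.
  have -> : (fun s => F' (tuple_upd t i s)) = (fun s : R =>
      partial i u (x + s *: delta_mx 0 i) *
        cos (a + 2 * pi * dotp x xi + K * s) -
      K * (u (x + s *: delta_mx 0 i) *
        cos (a - pi / 2 + 2 * pi * dotp x xi + K * s))).
    by apply/funext => s; rewrite /F' !CE updE.
  move=> s; apply: cvgB; apply: cvgM.
  - by apply: cline; exact: dpu.1.
  - exact: ccos.
  - exact: cvg_cst.
  - by apply: cvgM; [apply: cline; exact: du.1|exact: ccos].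
rewrite /F' RintegralB//.
- rewrite RintegralZl//; last exact: dominated_integrable (dominated_ctr _ _ du).
  by move=> /eqP; rewrite subr_eq0 => /eqP.
- exact: dominated_integrable (dominated_ctr _ _ dpu).
- exact: (integrableZl measurableT K (dominated_integrable (dominated_ctr _ _ du))).
Qed.

(** Each integration by parts brings out a factor [2 pi xi_i], which is at least
    [xi_i] in absolute value. *)
Lemma ctr_iter_partial u i (B : nat -> R) : Cinfty u ->
  (forall k x, `|iter k (partial i) u x| <= B k * wrow x) ->
  forall q a xi, `|xi 0 i| ^+ q * `|ctr u a xi| <= B q * pi ^+ n.
Proof.
move=> uoo hB q a xi.
have dk k : wdominated (iter k (partial i) u).
  by split; [exact/Cinfty_continuous/Cinfty_iter|exists (B k)].
have E k b : ctr (iter k (partial i) u) b xi =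
    (2 * pi * xi 0 i) ^+ k * ctr u (b - (pi / 2) *+ k) xi.
  elim: k b => [|k IH] b; first by rewrite expr0 mul1r mulr0n subr0.
  rewrite iterS ctr_partial ?IH; [|exact: Cinfty_iter|exact: dk|exact: (dk k.+1)].
  by rewrite exprS mulrA (mulrS (pi / 2)) opprD addrA.
have := ctr_bound (a + (pi / 2) *+ q) xi (dk q).1 (hB q).
rewrite E addrK normrM normrX; apply: le_trans; rewrite ler_wpM2r//.
rewrite lerXn2r ?nnegrE// normrM ler_peMl// ger0_norm ?mulr_ge0 ?pi_ge0//.
by have := pi_ge2 R; lra.
Qed.

End trigonometric_transform.

(** * The Poisson kernel as an approximate identity *)

Section approximate_identity.
Context {R : realType}.
Local Notation mR := (measurableTypeR R).
Local Notation mu := (@lebesgue_measure R).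
Local Notation L n := (lebesgue_tuple R n).

Lemma dominated_prod n (g : 'I_n -> R -> R) :
  (forall i, oneDsqrV_bounded (g i)) ->
  dominated (fun t : n.-tuple mR => \prod_(i < n) g i (tnth t i)).
Proof.
move=> bg; split; first by apply: measurable_prod_tnth => i; exact: (bg i).1.
have [C hC] := choice (fun i => (bg i).2).
exists (\prod_(i < n) C i) => t; rewrite normr_prod /wt -big_split/=.
by apply: ler_prod => i _; rewrite normr_ge0 hC.
Qed.

Lemma dominated_abel n (e : R) : 0 < e ->
  dominated (fun t : n.-tuple mR => \prod_(i < n) abel e (tnth t i)).
Proof. by move=> e0; apply: (@dominated_prod n (fun=> abel e)) => i; exact: abel_bounded. Qed.

Lemma abel_prod_le1 n (e : R) (t : n.-tuple mR) : 0 < e ->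
  `|\prod_(i < n) abel e (tnth t i)| <= 1.
Proof.
move=> e0; rewrite normr_prod; apply: prodr_ile1 => i _.
by rewrite normr_ge0 gtr0_norm ?abel_gt0// abel_le1.
Qed.

(** The inner variables see the outer one only through the phase. *)
Lemma Rintegral_abel_prod n (e a : R) (z : 'I_n -> R) : 0 < e ->
  \int[L n]_t ((\prod_(i < n) abel e (tnth t i)) *
     cos (a + 2 * pi * \sum_(i < n) z i * tnth t i)) =
  cos a * \prod_(i < n) poisson e (z i).
Proof.
move=> e0; elim: n a z => [|n IH] a z.
  by rewrite Rintegral_tuple0 !big_ord0 mulr0 addr0 mul1r mulr1.
pose F m (b : R) (w : 'I_m -> R) (t : m.-tuple mR) :=
  (\prod_(i < m) abel e (tnth t i)) *
  cos (b + 2 * pi * \sum_(i < m) w i * tnth t i).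
have dF m b w : dominated (F m b w).
  apply: (dominatedM (dominated_abel m e0) (C := 1)); last first.
    by move=> t; exact: cos_max.
  apply: (measurableT_comp (continuous_measurable_fun (@continuous_cos R))).
  apply: measurable_funD => //; apply: measurable_funM => //.
  apply: measurable_sum => i; apply: measurable_funM => //.
  exact: measurable_tnth.
have E x u : F n.+1 a z (tcons (x, u)) = abel e x *
    F n (a + 2 * pi * z ord0 * x) (fun i => z (lift ord0 i)) u.
  rewrite /F !big_ord_recl tnth_tcons0 -mulrA; congr (_ * (_ * cos _)).
    by apply: eq_bigr => i _; rewrite tnth_tconsS.
  rewrite mulrDr addrA mulrA; congr (_ + _ * _).
  by apply: eq_bigr => i _; rewrite tnth_tconsS.
rewrite (dominated_Rintegral1 (dF n.+1 a z)).
under eq_Rintegral => x _.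
  under eq_Rintegral => u _ do rewrite E.
  rewrite RintegralZl//; last exact/dominated_integrable/dF.
  rewrite IH mulrA.
  over.
rewrite RintegralZr//.
  by rewrite Rintegral_abel_cos// big_ord_recl mulrA.
apply: integrable_oneDsqrV_bounded; split.
  apply: measurable_funM; first exact: (abel_bounded e0).1.
  apply: continuous_measurable_fun => x.
  apply: (@continuous_comp _ _ _ (fun t => a + 2 * pi * z ord0 * t) (@cos R)).
    apply: cvgD; first exact: cvg_cst.
    by apply: cvgM; [exact: cvg_cst|exact: cvg_id].
  exact: continuous_cos.
have [_ [C hC]] := abel_bounded e0; exists C => x.
by rewrite normrM (le_trans _ (hC x))// ler_piMr// cos_max.
Qed.

Context {n : nat}.
Implicit Types (u : 'rV[R]_n -> R) (x xi : 'rV[R]_n) (e : R).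

Definition poisson_prod e x (t : n.-tuple mR) : R :=
  \prod_(i < n) poisson e (x 0 i - tnth t i).

Lemma dominated_poisson_prod e x : 0 < e -> dominated (poisson_prod e x).
Proof.
move=> e0; apply: (@dominated_prod _ (fun i t => poisson e (x 0 i - t))) => i.
exact: poisson_bounded.
Qed.

Lemma poisson_prod_ge0 e x t : 0 < e -> 0 <= poisson_prod e x t.
Proof. by move=> e0; apply: prodr_ge0 => i _; exact: poisson_ge0. Qed.

Lemma Rintegral_poisson_prod e x : 0 < e -> \int[L n]_t poisson_prod e x t = 1.
Proof.
move=> e0; have [|_ ->] := @integral_prod_tnth R n (fun i t => poisson e (x 0 i - t)).
  by move=> i; exact/integrable_oneDsqrV_bounded/poisson_bounded.
by rewrite big1// => i _; rewrite Rintegral_poisson.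
Qed.

Let tail d x (j : 'I_n) (t : n.-tuple mR) : R :=
  (x 0 j - tnth t j) ^+ 2 / ((x 0 j - tnth t j) ^+ 2 + d ^+ 2).

Lemma integral_poisson_prod_tail e d x j : 0 < e -> e < d ->
  (L n).-integrable setT (EFin \o (fun t => tail d x j t * poisson_prod e x t)) /\
  \int[L n]_t (tail d x j t * poisson_prod e x t) = e / (e + d).
Proof.
move=> e0 ed; have d0 : 0 < d by exact: lt_trans ed.
pose s (y : R) := (x 0 j - y) ^+ 2 / ((x 0 j - y) ^+ 2 + d ^+ 2).
pose g (i : 'I_n) (y : R) := (if i == j then s y else 1) * poisson e (x 0 i - y).
have s1 y : 0 <= s y <= 1.
  rewrite divr_ge0 ?addr_ge0 ?sqr_ge0//= ler_pdivrMr ?mul1r ?lerDl ?sqr_ge0//.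
  by rewrite addrC sqrD_gt0.
have ms : measurable_fun setT s.
  apply: continuous_measurable_fun => y.
  have c : (x 0 j - r) @[r --> y] --> x 0 j - y.
    by apply: cvgB; [exact: cvg_cst|exact: cvg_id].
  have c2 : ((x 0 j - r) ^+ 2) @[r --> y] --> (x 0 j - y) ^+ 2.
    by under eq_fun do rewrite expr2; rewrite expr2; exact: cvgM.
  apply: cvgM => //; apply: cvgV; first by rewrite gt_eqF// addrC sqrD_gt0.
  by apply: cvgD => //; exact: cvg_cst.
have bg i : oneDsqrV_bounded (g i).
  have [mp [C hC]] := poisson_bounded (x 0 i) e0; split.
    by apply: measurable_funM => //; case: (i == j).
  exists C => y; rewrite normrM (le_trans _ (hC y))// ler_piMl//.
  by case: (i == j); rewrite ?normr1// ger0_norm; case/andP: (s1 y).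
have [ig gE] := @integral_prod_tnth R n g (fun i => integrable_oneDsqrV_bounded (bg i)).
have E t : tail d x j t * poisson_prod e x t = \prod_(i < n) g i (tnth t i).
  rewrite /g big_split/=; congr (_ * _); rewrite (bigD1 j)//= eqxx.
  by rewrite big1 ?mulr1// => i /negbTE ->.
split; first by under [X in EFin \o X]eq_fun do rewrite E.
under eq_Rintegral => t _ do rewrite E.
rewrite gE (bigD1 j)//= big1 ?mulr1.
  by rewrite /g eqxx Rintegral_poisson_tail.
move=> i /negbTE ij; rewrite /g ij.
by under eq_Rintegral do rewrite mul1r; exact: Rintegral_poisson.
Qed.

(** Near [x] the oscillation of [u] is small by continuity; away from [x] some
    coordinate satisfies [|x_j - t_j| >= d], where [tail d x j] is at least
    [1 / 2], and the tails have small integral. *)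
Lemma poisson_approximation u x (A : R) : continuous u ->
  (forall y, `|u y| <= A) ->
  \int[L n]_t (u (row_of_tuple t) * poisson_prod e x t) @[e --> 0^'+] --> u x.
Proof.
move=> cu uA; have A0 : 0 <= A by exact: le_trans (uA x).
apply/cvgrPdist_le => eta eta0.
have eta20 : 0 < eta / 2 by rewrite divr_gt0.
have [d d0 hd] := continuous_coord x cu eta20.
(* makes the tails contribute 4 A n e / (e + d) <= eta / 2 for e < c *)
pose c := eta * d / (8 * (A * n%:R + 1)).
have An0 : 0 < 8 * (A * n%:R + 1) by rewrite mulr_gt0// ltr_wpDl ?mulr_ge0.
have c0 : 0 < c by rewrite divr_gt0// mulr_gt0.
near=> e; have e0 : 0 < e by [].
have ed : e < d by near: e; exact: nbhs_right_lt.
have ec : e < c by near: e; exact: nbhs_right_lt.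
have P0 t := poisson_prod_ge0 x t e0.
have dP := dominated_poisson_prod x e0.
have iP := dominated_integrable dP.
have mu' : measurable_fun setT (u \o row_of_tuple) by exact: measurable_row_of_tuple.
have duP : dominated (fun t => u (row_of_tuple t) * poisson_prod e x t).
  apply: (@dominated_le _ _ _ (poisson_prod e x) A) => //.
    by apply: measurable_funM => //; exact: dP.1.
  by move=> t; rewrite normrM ler_wpM2r.
have dxP : dominated (fun t => u x * poisson_prod e x t) by exact: dominatedZ.
have osc t : `|u x - u (row_of_tuple t)| <= eta / 2 + 4 * A * \sum_(j < n) tail d x j t.
  have t0 j : 0 <= tail d x j t by rewrite divr_ge0 ?addr_ge0 ?sqr_ge0.
  have [near|/forallPn[j]] := boolP [forall j, `|x 0 j - tnth t j| < d].
    rewrite (@le_trans _ _ (eta / 2))//.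
      by apply/ltW/hd => j; rewrite mxE; exact: (forallP near j).
    by rewrite lerDl mulr_ge0 ?mulr_ge0// sumr_ge0.
  rewrite -leNgt => far; have tj : 1 <= 2 * tail d x j t.
    rewrite mulrA ler_pdivlMr ?mul1r; last by rewrite addrC sqrD_gt0.
    rewrite mulr_natl mulr2n lerD2l -[leRHS]real_normK ?num_real//.
    by rewrite lerXn2r ?nnegrE// ltW.
  apply: (@le_trans _ _ (4 * A * tail d x j t)); last first.
    rewrite (bigD1 j)//= mulrDr addrCA lerDl addr_ge0 ?(ltW eta20)//.
    by rewrite mulr_ge0 ?mulr_ge0// sumr_ge0.
  have := ler_wpM2l A0 tj; have := uA x; have := uA (row_of_tuple t).
  have := ler_normB (u x) (u (row_of_tuple t)).
  by rewrite mulr1; lra.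
have iT (j : 'I_n) := integral_poisson_prod_tail x j e0 ed.
pose H t := eta / 2 * poisson_prod e x t +
  4 * A * \sum_(j < n) (tail d x j t * poisson_prod e x t).
have sumE : (fun t => \sum_(j < n) (tail d x j t * poisson_prod e x t)%:E)%E =
    EFin \o (fun t => \sum_(j < n) (tail d x j t * poisson_prod e x t)).
  by apply/funext => t /=; rewrite sumEFin.
have iS : (L n).-integrable setT
    (EFin \o (fun t => \sum_(j < n) (tail d x j t * poisson_prod e x t))).
  by rewrite -sumE; apply: integrable_sum => // j _; exact: (iT j).1.
have SE : \int[L n]_t (\sum_(j < n) (tail d x j t * poisson_prod e x t)) =
    n%:R * (e / (e + d)).
  rewrite /Rintegral -[X in integral _ _ X]/(EFin \o _) -sumE integral_sum//; last first.
    by move=> j; exact: (iT j).1.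
  rewrite (eq_bigr (fun=> (e / (e + d))%:E)).
    by rewrite sumEFin/= sumr_const card_ord mulr_natl.
  move=> j _; rewrite -(iT j).2 /Rintegral fineK// integrable_fin_num//.
  exact: (iT j).1.
have iHP := integrableZl measurableT (eta / 2) iP.
have iHS := integrableZl measurableT (4 * A) iS.
have iH : (L n).-integrable setT (EFin \o H).
  exact: (integrableD measurableT iHP iHS).
have iD : (L n).-integrable setT (EFin \o (fun t =>
    u x * poisson_prod e x t - u (row_of_tuple t) * poisson_prod e x t)).
  exact: (integrableB measurableT (dominated_integrable dxP)
    (dominated_integrable duP)).
have -> : u x = \int[L n]_t (u x * poisson_prod e x t).
  by rewrite RintegralZl// Rintegral_poisson_prod// mulr1.
rewrite -RintegralB//; [|exact: dominated_integrable dxP|exact: dominated_integrable duP].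
rewrite (le_trans (le_normr_Rintegral _ iD))//.
apply: (@le_trans _ _ (\int[L n]_t H t)).
  apply: le_Rintegral => //; first exact: integrable_norm.
  move=> t _; rewrite -mulrBl normrM (ger0_norm (P0 t)).
  by rewrite /H -big_distrl/= mulrA -mulrDl ler_wpM2r.
rewrite RintegralD// !RintegralZl// SE Rintegral_poisson_prod// mulr1.
have : 4 * A * (n%:R * (e / (e + d))) <= eta / 2.
  apply: (@le_trans _ _ (4 * (A * n%:R + 1) * (e / d))).
    rewrite !mulrA -mulrA -[leRHS]mulrA ler_pM//.
    - by rewrite mulr_ge0// mulr_ge0.
    - by rewrite divr_ge0// ltW// addr_gt0.
    - by rewrite -mulrA ler_wpM2l// lerDl.
    - by rewrite ler_wpM2l ?(ltW e0)// lef_pV2 ?posrE ?addr_gt0// lerDr ltW.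
  move: ec; rewrite /c ltr_pdivlMr// => ec.
  by rewrite mulrA ler_pdivrMr//; lra.
lra.
Unshelve. all: by end_near. Qed.

End approximate_identity.

(** * Fourier inversion for iterated differences *)

Section inversion.
Context {R : realType} {n : nat}.
Local Notation mR := (measurableTypeR R).
Local Notation L := (lebesgue_tuple R n).
Local Notation row := row_of_tuple.
Implicit Types (u : 'rV[R]_n -> R) (x xi : 'rV[R]_n) (a e : R).

(** Fourier inversion in regularized form: the Poisson mean of [u] at [x] is an
    integral of the transform of [u] against the summation factor [abel e]. *)
Lemma poisson_mean_ctr u x e : wdominated u -> 0 < e ->
  (forall y, L.-integrable setT (EFin \o (fun s : n.-tuple mR =>
     (\prod_(i < n) abel e (tnth s i)) *
     ctr u (0 + 2 * pi * dotp y (row s)) (- row s)))) /\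
  \int[L]_t (u (row t) * poisson_prod e x t) =
  \int[L]_s ((\prod_(i < n) abel e (tnth s i)) *
    ctr u (0 + 2 * pi * dotp x (row s)) (- row s)).
Proof.
move=> du e0.
pose K y (z : n.-tuple mR * n.-tuple mR) := (\prod_(i < n) abel e (tnth z.1 i)) *
  (u (row z.2) * cos (0 + 2 * pi * dotp y (row z.1) +
                      2 * pi * dotp (row z.2) (- row z.1))).
have dabel := @dominated_abel R n e e0.
have durow := wdominated_dominated du.
have mdot1 y : measurable_fun setT (fun z : n.-tuple mR * n.-tuple mR =>
    dotp y (row z.1)).
  apply: measurable_sum => i; apply: measurable_funM => //.
  under eq_fun do rewrite mxE.
  exact: measurableT_comp (measurable_tnth i) measurable_fst.
have mdot2 : measurable_fun setT (fun z : n.-tuple mR * n.-tuple mR =>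
    dotp (row z.2) (- row z.1)).
  apply: measurable_sum => i; under eq_fun do rewrite !mxE.
  apply: measurable_funM.
    exact: measurableT_comp (measurable_tnth i) measurable_snd.
  apply: measurable_funN.
  exact: measurableT_comp (measurable_tnth i) measurable_fst.
have mK y : measurable_fun setT (K y).
  apply: measurable_funM; first exact: measurableT_comp dabel.1 measurable_fst.
  apply: measurable_funM; first exact: measurableT_comp durow.1 measurable_snd.
  apply: (measurableT_comp (continuous_measurable_fun (@continuous_cos R))).
  by apply: measurable_funD; [apply: measurable_funD => //|];
    apply: measurable_funM.
have i1 := integrable_norm (dominated_integrable dabel).
have i2 := integrable_norm (dominated_integrable durow).
have Kw y s t : `|K y (s, t)| <=
    (Num.norm \o (fun s : n.-tuple mR => \prod_(i < n) abel e (tnth s i))) s *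
    (Num.norm \o (u \o row)) t.
  by rewrite /K normrM ler_wpM2l//= normrM ler_piMr// cos_max.
have KE y s : \int[L]_t K y (s, t) = (\prod_(i < n) abel e (tnth s i)) *
    ctr u (0 + 2 * pi * dotp y (row s)) (- row s).
  rewrite /K /= RintegralZl//.
  exact: dominated_integrable (dominated_ctr _ _ du).
split=> [y|].
  have := integrable_fubini_F (integrable_product (mK y) i1 i2 (Kw y)).
  apply: eq_integrable => // s _; rewrite /fubini_F /= -KE.
  rewrite /Rintegral fineK// integrable_fin_num//.
  exact: (integrable_section1 (mK y) i2 (Kw y)).
under [RHS]eq_Rintegral => s _ do rewrite -KE.
rewrite -(Rintegral_product1 (mK x) i1 i2 (Kw x)).
rewrite (Rintegral_product2 (mK x) i1 i2 (Kw x)); apply: eq_Rintegral => t _.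
have -> : (fun s => K x (s, t)) = (fun s => u (row t) *
    ((\prod_(i < n) abel e (tnth s i)) *
     cos (0 + 2 * pi * \sum_(i < n) (x 0 i - tnth t i) * tnth s i))).
  apply/funext => s; rewrite /K/= mulrCA; congr (_ * (_ * cos _)).
  rewrite -addrA -mulrDr; congr (_ + _ * _); rewrite /dotp -big_split/=.
  by apply: eq_bigr => i _; rewrite !mxE mulrN mulrBl.
have dG : dominated (fun s : n.-tuple mR => (\prod_(i < n) abel e (tnth s i)) *
     cos (0 + 2 * pi * \sum_(i < n) (x 0 i - tnth t i) * tnth s i)).
  apply: (dominatedM dabel (C := 1)); last by move=> s; exact: cos_max.
  apply: (measurableT_comp (continuous_measurable_fun (@continuous_cos R))).
  apply: measurable_funD => //; apply: measurable_funM => //.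
  apply: measurable_sum => i; apply: measurable_funM => //.
  exact: measurable_tnth.
rewrite RintegralZl//; last exact: dominated_integrable.
by rewrite Rintegral_abel_prod// cos0 mul1r.
Qed.

Lemma diffsZ (k : R) (f : 'rV[R]_n -> R) Lh x :
  diffs Lh (fun y => k * f y) x = k * diffs Lh f x.
Proof.
by elim: Lh x => //= jh Lh IH x; rewrite /shift_diff !IH mulrBr.
Qed.

(** Each difference of a wave of frequency [xi] costs a factor [2 sin (pi h xi_j)]
    and a change of phase. *)
Lemma diffs_ctr u a xi zeta (Lh : seq ('I_n * R)) : wdominated u ->
  all (fun jh => 0 < jh.2) Lh -> exists c b,
  `|c| <= \prod_(jh <- Lh) (2 * pi * `|xi 0 jh.1| * jh.2) /\
  forall x, diffs Lh (fun y => ctr u (a + 2 * pi * dotp y xi) zeta) x =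
    c * ctr u (b + 2 * pi * dotp x xi) zeta.
Proof.
move=> du; elim: Lh => [|[j h] Lh IH] /=.
  by move=> _; exists 1, a; rewrite big_nil normr1; split=> // x; rewrite mul1r.
move=> /andP[h0 /IH[c [b [hc hcb]]]].
pose s := pi * xi 0 j * h.
exists (c * (2 * sin s)), (b + s + pi / 2); split.
  rewrite big_cons/= mulrC normrM ler_pM//.
  rewrite normrM (ger0_norm (ler0n _ 2)) -!mulrA ler_wpM2l//.
  rewrite (le_trans (ler_norm_sin _))// /s !normrM (gtr0_norm h0).
  by rewrite (gtr0_norm (pi_gt0 R)) mulrA.
move=> x; rewrite /shift_diff/= !hcb dotp_line -mulrBr -[RHS]mulrA; congr (_ * _).
have -> : b + 2 * pi * (dotp x xi + xi 0 j * h) =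
    (b + 2 * pi * dotp x xi) + s *+ 2.
  by rewrite mulrDr addrA -[s *+ 2]mulr_natl /s !mulrA.
rewrite ctr_diff//; congr (_ * ctr _ _ _).
by rewrite (addrAC b _ s) (addrAC (b + s) _ (pi / 2)).
Qed.

(** For the Poisson means the bound holds with the summation factor replaced by
    [1], hence uniformly in [e]; it passes to the limit [u]. *)
Lemma diffs_le_ctr u (Lh : seq ('I_n * R)) (B : R) : wdominated u ->
  all (fun jh => 0 < jh.2) Lh ->
  (forall a xi, `|ctr u a xi| * \prod_(jh <- Lh) (2 * pi * `|xi 0 jh.1|) <=
     B * wrow xi) ->
  forall x, `|diffs Lh u x| <= B * pi ^+ n * \prod_(jh <- Lh) jh.2.
Proof.
move=> du Lh0 hB x; have [cu [A hA]] := du.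
have A0 : 0 <= A.
  by have := le_trans (normr_ge0 _) (hA 0); rewrite pmulr_lge0// wrow_gt0.
have w1 (y : 'rV[R]_n) : wrow y <= 1.
  apply: prodr_ile1 => i _.
  by rewrite invr_ge0 (ltW (oneDsqr_gt0 _))/= invf_le1 ?oneDsqr_gt0// lerDl sqr_ge0.
have uA y : `|u y| <= A by rewrite (le_trans (hA y))// ler_piMr ?w1.
pose Phi e y := \int[L]_t (u (row t) * poisson_prod e y t).
have Phi_cvg y : Phi e y @[e --> 0^'+] --> u y.
  exact: poisson_approximation cu uA.
have cvl : diffs Lh (Phi k) x @[k --> 0^'+] --> diffs Lh u x by exact: diffs_cvg.
rewrite leNgt; apply/negP => lgt.
have hgt : \forall e \near 0^'+,
    B * pi ^+ n * \prod_(jh <- Lh) jh.2 < `|diffs Lh (Phi e) x|.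
  exact: (cvgr_norm_gt _ cvl _ lgt).
have [e [e0 /= egt]] : exists e : R, 0 < e /\
    B * pi ^+ n * \prod_(jh <- Lh) jh.2 < `|diffs Lh (Phi e) x|.
  near (0 : R)^'+ => e; exists e; split => //.
  by near: e.
move: egt; apply/negP; rewrite -leNgt.
pose G (s : n.-tuple mR) y := (\prod_(i < n) abel e (tnth s i)) *
  ctr u (0 + 2 * pi * dotp y (row s)) (- row s).
have PhiE : Phi e = (fun y => \int[L]_s G s y).
  by apply/funext => y; have [_] := poisson_mean_ctr y du e0.
have iG y : L.-integrable setT (EFin \o (G ^~ y)).
  by have [iG _] := poisson_mean_ctr x du e0; exact: iG.
have [iD DE] := diffs_Rintegral Lh iG; rewrite PhiE DE.
pose H := \prod_(jh <- Lh) jh.2.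
have H0 : 0 <= H.
  rewrite /H big_seq; apply: prodr_ge0 => jh jhL.
  exact/ltW/(allP Lh0 _ jhL).
rewrite mulrAC; apply: Rintegral_le_wt.
  by apply/measurable_EFinP; exact: measurable_int (iD x).
move=> s; rewrite diffsZ normrM -[leRHS]mul1r ler_pM// ?abel_prod_le1//.
have [c [b [hc ->]]] := @diffs_ctr u 0 (row s) (- row s) Lh du Lh0.
rewrite ctrN normrM; set a := - _; have ha := hB a (row s).
apply: le_trans (ler_wpM2r (normr_ge0 _) hc) _.
rewrite big_split/= -/H -wrowE [leLHS]mulrAC [leRHS]mulrAC ler_wpM2r//.
by rewrite mulrC.
Unshelve. all: by end_near. Qed.

End inversion.

(** * Decay of a function and of its transform *)

Section coordinates.
Context {R : realType} {n : nat}.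
Implicit Types (x : 'rV[R]_n) (alpha : {ffun 'I_n -> nat}).

Lemma max_coord x : (0 < n)%N -> exists i, forall j, `|x 0 j| <= `|x 0 i|.
Proof.
move=> n0; have [i _ hi] := @arg_maxP _ _ _ (Ordinal n0) predT (fun i => `|x 0 i|) isT.
by exists i => j; exact: hi.
Qed.

Definition single (i : 'I_n) (q : nat) : {ffun 'I_n -> nat} :=
  [ffun j => if j == i then q else 0%N].

Lemma mabs_single i q : mabs (single i q) = q.
Proof.
rewrite /mabs (bigD1 i)//= ffunE eqxx big1 ?addn0// => j ji.
by rewrite ffunE (negbTE ji).
Qed.

Lemma mpow_single x i q : mpow x (single i q) = x 0 i ^+ q.
Proof.
rewrite /mpow (bigD1 i)//= ffunE eqxx big1 ?mulr1// => j ji.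
by rewrite ffunE (negbTE ji).
Qed.

Lemma ipartial_single (u : 'rV[R]_n -> R) i q :
  ipartial (enum 'I_n) (single i q) u = iter q (partial i) u.
Proof.
have := enum_uniq 'I_n; have : i \in enum 'I_n by rewrite mem_enum.
elim: (enum 'I_n) => //= j s IH; rewrite inE => /orP[/eqP <-|js] /andP[ins us].
  rewrite ffunE eqxx ipartial0// => k ks; rewrite ffunE.
  by case: eqP => // ki; rewrite -ki ks in ins.
have ji : j != i by apply: contraNneq ins => ->.
by rewrite ffunE (negbTE ji)/= IH.
Qed.

Lemma norm_mpow_le x alpha i : (forall j, `|x 0 j| <= `|x 0 i|) ->
  `|mpow x alpha| <= `|x 0 i| ^+ mabs alpha.
Proof.
move=> hi; rewrite /mpow /mabs normr_prod expr_sum.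
apply: ler_prod => j _; rewrite normr_ge0/= normrX.
by rewrite lerXn2r ?nnegrE.
Qed.

(** With [m] the largest coordinate in absolute value, [1 / wrow x] is at most
    [(1 + m ^ 2) ^ n <= 2 ^ n (1 + m ^ (2 n))]. *)
Lemma le_wrow x (F B1 B2 : R) : (0 < n)%N -> 0 <= F -> F <= B1 ->
  (forall i, `|x 0 i| ^+ n.*2 * F <= B2) -> F <= 2 ^+ n * (B1 + B2) * wrow x.
Proof.
move=> n0 F0 FB1 FB2; have [i hi] := max_coord x n0.
set m := `|x 0 i|; have [s sE] : exists s, s = m ^+ 2 by exists (m ^+ 2).
have s0 : 0 <= s by rewrite sE sqr_ge0.
have wV : (wrow x)^-1 <= (1 + s) ^+ n.
  rewrite /wrow -prodfV -[in leRHS](card_ord n) -prodr_const.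
  apply: ler_prod => j _; rewrite invrK ltW ?oneDsqr_gt0//=.
  by rewrite lerD2l sE /m -[leLHS]real_normK ?num_real// lerXn2r ?nnegrE//; exact: hi.
have sn : (1 + s) ^+ n <= 2 ^+ n * (1 + s ^+ n).
  have [s1|/ltW s1] := leP s 1.
    rewrite -[leLHS]mulr1 ler_pM ?exprn_ge0 ?addr_ge0//.
      by rewrite lerXn2r ?nnegrE ?addr_ge0//; lra.
    by rewrite lerDl exprn_ge0.
  apply: (@le_trans _ _ ((2 * s) ^+ n)).
    by rewrite lerXn2r ?nnegrE ?addr_ge0 ?mulr_ge0//; lra.
  by rewrite exprMn ler_wpM2l ?exprn_ge0// lerDr.
rewrite -ler_pdivrMr ?wrow_gt0//.
apply: (le_trans (ler_wpM2l F0 (le_trans wV sn))).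
rewrite mulrCA ler_wpM2l ?exprn_ge0// mulrDr mulr1 lerD// mulrC sE -exprM mul2n.
exact: FB2.
Qed.

End coordinates.

Section decay.
Context {R : realType} {n : nat} (hn : (0 < n)%N) (sigma : R).
Hypothesis sigma1 : 1 < sigma.
Implicit Types (u f : 'rV[R]_n -> R).
Local Notation M tau := (Mseq tau sigma).

(** Powers of one coordinate stand for all monomials of the same degree. *)
Definition decays f : Prop := forall tau, 0 < tau -> exists2 C, 0 < C &
  forall i q (x : 'rV[R]_n), `|x 0 i| ^+ q * `|f x| <= C * M tau q.

Definition partials_bounded u : Prop := forall tau, 0 < tau -> exists2 C, 0 < C &
  forall beta (x : 'rV[R]_n),
    `|ipartial (enum 'I_n) beta u x| <= C * M tau (mabs beta).

Definition ctr_decays u : Prop := forall tau, 0 < tau -> exists2 C, 0 < C &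
  forall a i q (xi : 'rV[R]_n), `|xi 0 i| ^+ q * `|ctr u a xi| <= C * M tau q.

Lemma decays_le f g (k : R) : 0 < k -> (forall x, `|g x| <= k * `|f x|) ->
  decays f -> decays g.
Proof.
move=> k0 gf df tau tau0; have [C C0 hC] := df tau tau0.
exists (k * C); first exact: mulr_gt0.
move=> i q x; rewrite -mulrA.
apply: (le_trans _ (ler_wpM2l (ltW k0) (hC i q x))).
by rewrite mulrCA ler_wpM2l// exprn_ge0.
Qed.

Lemma decays_wdominated u : continuous u -> decays u -> wdominated u.
Proof.
move=> cu du; split=> //; have [C C0 hC] := du 1 ltr01.
exists (2 ^+ n * (C * M 1 0 + C * M 1 n.*2)) => x.
apply: le_wrow => //.
by have := hC (Ordinal hn) 0%N x; rewrite expr0 mul1r.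
Qed.

Lemma partials_decay_wrow u tau : 0 < tau -> Cinfty u -> decays u ->
  partials_bounded u -> exists2 C, 0 < C &
  forall i k x, `|iter k (partial i) u x| <= C * M tau k * wrow x.
Proof.
move=> tau0 uoo du dp; have [C C0 hC] := decay_ipartial sigma1 uoo du dp tau0.
exists (2 ^+ n * (C + C * M tau n.*2)).
  by rewrite mulr_gt0 ?exprn_gt0// addr_gt0// mulr_gt0// Mseq_gt0.
move=> i k x.
have hk j q : `|x 0 j| ^+ q * `|iter k (partial i) u x| <= C * M tau q * M tau k.
  by have := hC (single i k) j q x; rewrite ipartial_single mabs_single.
have -> : 2 ^+ n * (C + C * M tau n.*2) * M tau k =
    2 ^+ n * (C * M tau k + C * M tau n.*2 * M tau k) by ring.
apply: le_wrow => //.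
by have := hk i 0%N; rewrite expr0 mul1r Mseq0 mulr1.
Qed.

(** Decay of the transform: integrate by parts, with the integrable bound on the
    derivatives of one variable. *)
Lemma ctr_decays_of_partials u : Cinfty u -> decays u -> partials_bounded u ->
  ctr_decays u.
Proof.
move=> uoo du dp tau tau0.
have [C C0 hC] := partials_decay_wrow tau0 uoo du dp.
exists (C * pi ^+ n); first by rewrite mulr_gt0// exprn_gt0// pi_gt0.
move=> a i q xi; rewrite mulrAC.
exact: (ctr_iter_partial uoo (hC i)).
Qed.

(** The derivative as a list of single derivatives, innermost first, which is the
    form matched with iterated differences. *)
Lemma ipartial_foldl (s : seq 'I_n) (beta : {ffun 'I_n -> nat}) : exists J : seq 'I_n,
  size J = (\sum_(i <- s) beta i)%N /\
  forall u, ipartial s beta u = foldl (fun g j => partial j g) u J.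
Proof.
elim: s => [|i s [J [sJ hJ]]]; first by exists [::]; rewrite big_nil.
exists (J ++ nseq (beta i) i); split.
  by rewrite size_cat size_nseq sJ big_cons addnC.
move=> u; rewrite foldl_cat -hJ /=; elim: (beta i) (ipartial s beta u) => //= k IH g.
by rewrite -IH -iterSr.
Qed.

(** Converse: the bounds on the transform control the differences of [u] through
    the inversion formula, each difference in [x_j] costing a factor
    [2 pi h |xi_j|], and hence its derivatives. *)
Lemma partials_of_ctr_decays u : Cinfty u -> wdominated u -> ctr_decays u ->
  partials_bounded u.
Proof.
move=> uoo du dc tau tau0.
have tau20 : 0 < tau / 2 by rewrite divr_gt0.
have [tau1 /andP[tau10 tau12] [C1 C10 hC1]] := Mseq_double sigma1 tau20.
have [C C0 hC] := dc _ tau10.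
have [C3 C30 hC3] := Mseq_absorb sigma1 8 tau20.
pose C4 := 2 ^+ n * C3 * C * (1 + C1 * M (tau / 2) n.*2) * pi ^+ n.
have C40 : 0 < C4.
  rewrite !mulr_gt0 ?exprn_gt0 ?pi_gt0// ltr_pwDl// mulr_ge0 ?(ltW C10)//.
  exact: ltW (Mseq_gt0 _ _ _).
exists C4 => // beta x; have [J [sJ ->]] := ipartial_foldl (enum 'I_n) beta.
rewrite big_enum/= -/(mabs beta) in sJ; set N := mabs beta in sJ *.
have M0 t p : 0 <= M t p by rewrite ltW// Mseq_gt0.
apply: le_iter_partial_of_diffs => // hs sh hs0 {}x.
have z1 : unzip1 (zip J hs) = J by rewrite unzip1_zip// sh.
have z2 : unzip2 (zip J hs) = hs by rewrite unzip2_zip// sh.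
pose B := 2 ^+ n * ((2 * pi) ^+ N * C * M tau1 N + (2 * pi) ^+ N * C * M tau1 (N + n.*2)).
have hB a (xi : 'rV[R]_n) : `|ctr u a xi| *
    \prod_(jh <- zip J hs) (2 * pi * `|xi 0 jh.1|) <= B * wrow xi.
  rewrite -(big_map fst predT (fun j => 2 * pi * `|xi 0 j|)) -/(unzip1 _) z1.
  have [i hi] := max_coord xi hn; set m := `|xi 0 i|.
  have m0 : 0 <= m by exact: normr_ge0.
  have pi20 : 0 <= 2 * pi :> R by rewrite mulr_ge0// pi_ge0.
  have PJ : \prod_(j <- J) (2 * pi * `|xi 0 j|) <= (2 * pi) ^+ N * m ^+ N.
    rewrite -exprMn -sJ; elim: (J) => [|j J' IH]; first by rewrite big_nil expr0.
    rewrite big_cons exprS ler_pM//; first by rewrite mulr_ge0.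
      by apply: prodr_ge0 => k _; rewrite mulr_ge0.
    by rewrite ler_wpM2l// hi.
  have P0 : 0 <= \prod_(j <- J) (2 * pi * `|xi 0 j|).
    by apply: prodr_ge0 => j _; rewrite mulr_ge0.
  apply: le_wrow => //; first by rewrite mulr_ge0.
    apply: (le_trans (ler_wpM2l (normr_ge0 _) PJ)).
    by rewrite mulrCA -mulrA ler_wpM2l ?exprn_ge0// mulrC hC.
  move=> j; rewrite mulrA mulrC.
  apply: (@le_trans _ _ ((2 * pi) ^+ N * m ^+ N * (m ^+ n.*2 * `|ctr u a xi|))).
    by rewrite ler_pM// ?mulr_ge0 ?exprn_ge0// ler_wpM2r// lerXn2r ?nnegrE//.
  rewrite -!mulrA ler_wpM2l ?exprn_ge0// [leLHS]mulrA -exprD.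
  exact: hC.
have Lh0 : all (fun jh => 0 < jh.2) (zip J hs).
  by rewrite -(all_map snd (fun h => 0 < h)) -/(unzip2 _) z2.
have := diffs_le_ctr du Lh0 hB x.
rewrite -(big_map snd predT id) -/(unzip2 _) z2 => /le_trans; apply.
apply: ler_wpM2r.
  rewrite big_seq; apply: prodr_ge0 => h hhs.
  exact: ltW (allP hs0 _ hhs).
rewrite /B /C4 [leRHS]mulrAC ler_wpM2r ?exprn_ge0 ?pi_ge0//.
have K : (2 * pi) ^+ N <= C3 * M (tau / 2) N.
  apply: le_trans (hC3 N); apply: (@le_trans _ _ (8 ^+ N)).
    by rewrite lerXn2r ?nnegrE ?mulr_ge0 ?pi_ge0//; have := pihalf_lt2 R; lra.
  apply: (@le_trans _ _ ((8 * N.+1)%:R ^+ N)).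
    by rewrite lerXn2r ?nnegrE// ler_nat leq_pmulr.
  by apply: ler_weXn2l; [rewrite ler1n|exact: leq_pmull].
have K1 : M tau1 N <= M (tau / 2) N by exact: ler_Mseq_tau.
have K2 : M tau1 (N + n.*2) <= C1 * (M (tau / 2) N * M (tau / 2) n.*2).
  apply: (@le_trans _ _ (M tau1 (maxn N n.*2).*2)).
    by rewrite ler_Mseq ?(ltW tau10)// -[X in (_ <= X)%N]addnn leq_add ?leq_maxl ?leq_maxr.
  rewrite (le_trans (hC1 _))// ler_wpM2l ?(ltW C10)//.
  have M1 p : 1 <= M (tau / 2) p by rewrite Mseq_ge1// ltW.
  have [_|_] := leqP N n.*2; first by rewrite ler_peMl.
  by rewrite ler_peMr.
have CK : (2 * pi) ^+ N * (C * (M tau1 N + M tau1 (N + n.*2))) <=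
    C3 * M (tau / 2) N *
    (C * (M (tau / 2) N + C1 * (M (tau / 2) N * M (tau / 2) n.*2))).
  rewrite ler_pM ?exprn_ge0 ?mulr_ge0 ?pi_ge0 ?addr_ge0 ?(ltW C0)//.
  by rewrite ler_wpM2l ?(ltW C0)// lerD.
rewrite -!mulrA ler_wpM2l ?exprn_ge0// -mulrDr -mulrDr (Mseq_half sigma tau N).
apply: (le_trans CK); rewrite le_eqVlt; apply/orP; left; apply/eqP; ring.
Qed.

End decay.

(** * Complex-valued functions *)

Section complex_modulus.
Context {R : realType}.
Local Notation normc := ComplexField.Normc.normc.
Implicit Types (z : R[i]) (a b : R).

Lemma normc_ge0 z : 0 <= normc z.
Proof. by case: z => a b; exact: sqrtr_ge0. Qed.

Lemma normc_ge_Re z : `|complex.Re z| <= normc z.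
Proof.
by case: z => a b /=; rewrite -sqrtr_sqr ler_wsqrtr// lerDl sqr_ge0.
Qed.

Lemma normc_ge_Im z : `|complex.Im z| <= normc z.
Proof.
by case: z => a b /=; rewrite -sqrtr_sqr ler_wsqrtr// lerDr sqr_ge0.
Qed.

Lemma normc_le z : normc z <= `|complex.Re z| + `|complex.Im z|.
Proof.
case: z => a b /=; rewrite -[leRHS]ger0_norm ?addr_ge0// -sqrtr_sqr ler_wsqrtr//.
rewrite sqrrD !real_normK ?num_real// addrAC lerDl.
by rewrite mulrn_wge0// mulr_ge0.
Qed.

Lemma normcZ a z : normc (a%:C%C * z) = `|a| * normc z.
Proof.
by rewrite ComplexField.Normc.normcM /= expr0n/= addr0 sqrtr_sqr.
Qed.

End complex_modulus.

Section gelfand_shilov_conditions.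
Context {R : realType} {n : nat} (hn : (0 < n)%N) (sigma : R).
Hypothesis sigma1 : 1 < sigma.
Local Notation M tau := (Mseq tau sigma).
Local Notation normc := ComplexField.Normc.normc.
Implicit Types (phi psi : 'rV[R]_n -> R[i]) (x xi : 'rV[R]_n).

Lemma sup_norm_leP psi (c : R) :
  (sup_norm psi <= c%:E)%E <-> forall x, normc (psi x) <= c.
Proof.
split=> [h x|h]; first by rewrite -lee_fin (le_trans _ h)//; apply: ereal_sup_ubound; exists x.
by apply: ge_ereal_sup => _ [x _ <-]; rewrite lee_fin.
Qed.

Lemma mpartial_ipartial phi (beta : {ffun 'I_n -> nat}) :
  mpartial beta phi = (fun x => Complex
    (ipartial (enum 'I_n) beta (fun y => complex.Re (phi y)) x)
    (ipartial (enum 'I_n) beta (fun y => complex.Im (phi y)) x)).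
Proof.
rewrite /mpartial; elim: (enum 'I_n) => [|i s IH] /=.
  by apply/funext => x; case: (phi x).
by rewrite IH; elim: (beta i) => //= k ->.
Qed.

Definition monomial_decay psi : Prop := forall tau, 0 < tau -> exists2 C, 0 < C &
  forall alpha : {ffun 'I_n -> nat},
    (sup_norm (fun x => (mpow x alpha)%:C%C * psi x)%R <=
      (C * M tau (mabs alpha))%:E)%E.

Lemma decays_of_monomial psi : monomial_decay psi ->
  decays sigma (fun x => normc (psi x)).
Proof.
move=> dp tau tau0; have [C C0 hC] := dp tau tau0; exists C => // i q x.
have /sup_norm_leP/(_ x) := hC (single i q).
by rewrite normcZ mpow_single mabs_single normrX (ger0_norm (normc_ge0 _)).
Qed.

Lemma monomial_of_decays psi : decays sigma (fun x => normc (psi x)) ->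
  monomial_decay psi.
Proof.
move=> dp tau tau0; have [C C0 hC] := dp tau tau0; exists C => // alpha.
apply/sup_norm_leP => x; rewrite normcZ; have [i hi] := max_coord x hn.
rewrite (le_trans _ (hC i (mabs alpha) x))// (ger0_norm (normc_ge0 _)).
by rewrite ler_wpM2r ?normc_ge0// norm_mpow_le.
Qed.

Lemma decays_Re psi : decays sigma (fun x => normc (psi x)) ->
  decays sigma (fun x => complex.Re (psi x)).
Proof.
apply: (decays_le (k := 1)) => // x.
by rewrite mul1r (ger0_norm (normc_ge0 _)) normc_ge_Re.
Qed.

Lemma decays_Im psi : decays sigma (fun x => normc (psi x)) ->
  decays sigma (fun x => complex.Im (psi x)).
Proof.
apply: (decays_le (k := 1)) => // x.
by rewrite mul1r (ger0_norm (normc_ge0 _)) normc_ge_Im.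
Qed.

Lemma le_norm_enorm x i : `|x 0 i| <= enorm x.
Proof.
rewrite -sqrtr_sqr ler_wsqrtr// (bigD1 i)//= lerDl.
by apply: sumr_ge0 => j _; rewrite sqr_ge0.
Qed.

Lemma enorm_le x i : (forall j, `|x 0 j| <= `|x 0 i|) -> enorm x <= n%:R * `|x 0 i|.
Proof.
move=> hi; rewrite /enorm -[leRHS]ger0_norm ?mulr_ge0// -sqrtr_sqr ler_wsqrtr//.
rewrite exprMn; apply: (@le_trans _ _ (n%:R * `|x 0 i| ^+ 2)).
  rewrite mulr_natl -[X in _ *+ X](card_ord n) -sumr_const; apply: ler_sum => j _.
  by rewrite -[leLHS]real_normK ?num_real// lerXn2r ?nnegrE.
by rewrite ler_wpM2r ?exprn_ge0// -natrX ler_nat expnS expn1 leq_pmulr.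
Qed.

(** The supremum over [p] of [r ^ p / M_p] is the exponential of the associated
    function; the passage from coordinates to the Euclidean norm costs [n ^ p],
    which the weights absorb. *)
Lemma assoc_bound_of_decays psi : decays sigma (fun x => normc (psi x)) ->
  forall tau, 0 < tau -> (ereal_sup (range (fun x =>
    (normc (psi x))%:E * expeR (assoc_fun tau sigma (enorm x)))) < +oo)%E.
Proof.
move=> dp tau tau0; have tau20 : 0 < tau / 2 by rewrite divr_gt0.
have [C C0 hC] := dp _ tau20.
have [C3 C30 hC3] := Mseq_absorb sigma1 n tau20.
pose K := C3 * C; have K0 : 0 < K by rewrite mulr_gt0.
have hK x p : enorm x ^+ p * normc (psi x) <= K * M tau p.
  have [i hi] := max_coord x hn.
  apply: (@le_trans _ _ ((n%:R * `|x 0 i|) ^+ p * normc (psi x))).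
    by rewrite ler_wpM2r ?normc_ge0// lerXn2r ?nnegrE ?sqrtr_ge0 ?mulr_ge0// enorm_le.
  rewrite exprMn -mulrA (Mseq_half sigma tau) /K mulrACA.
  rewrite ler_pM ?exprn_ge0 ?mulr_ge0 ?exprn_ge0 ?normc_ge0//.
    apply: le_trans (hC3 p); rewrite -!natrX ler_nat.
    rewrite (@leq_trans ((n * p.+1) ^ p))//; last first.
      by rewrite leq_pexp2l ?muln_gt0 ?hn// leq_pmull.
    by case: (p) => // k; rewrite leq_exp2r// leq_pmulr.
  by have := hC i p x; rewrite (ger0_norm (normc_ge0 _)).
apply: (@le_lt_trans _ _ K%:E); last by rewrite ltry.
apply: ge_ereal_sup => _ [x _ <-].
have := hK x 0%N; rewrite expr0 mul1r Mseq0 mulr1 => hK0.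
rewrite /assoc_fun; case: ifPn => [r0|_]; last by rewrite /= expR0 mule1 lee_fin.
have [->|F0] := eqVneq (normc (psi x)) 0; first by rewrite mul0e lee_fin ltW.
have {}F0 : 0 < normc (psi x) by rewrite lt0r F0 normc_ge0.
apply: (@le_trans _ _ ((normc (psi x))%:E * (K / normc (psi x))%:E)%E); last first.
  by rewrite -EFinM mulrCA mulfV ?gt_eqF// mulr1.
rewrite lee_pmul2l//.
have KF0 : 0 < K / normc (psi x) by rewrite divr_gt0.
rewrite -[leRHS](_ : expeR (ln (K / normc (psi x)))%:E = _); last first.
  by rewrite /= lnK.
rewrite lee_expeR; apply: ge_ereal_sup => _ [p _ <-]; rewrite lee_fin.
have rM0 : 0 < enorm x ^+ p / M tau p by rewrite divr_gt0 ?exprn_gt0 ?Mseq_gt0.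
rewrite ler_ln ?posrE// ler_pdivrMr ?Mseq_gt0// mulrAC ler_pdivlMr//.
Qed.

Lemma decays_of_assoc_bound psi : (forall tau, 0 < tau -> (ereal_sup (range (fun x =>
    (normc (psi x))%:E * expeR (assoc_fun tau sigma (enorm x)))) < +oo)%E) ->
  decays sigma (fun x => normc (psi x)).
Proof.
move=> hT tau tau0; have := hT tau tau0; set S := ereal_sup _ => Soo.
have [K [K0 hK]] : exists K : R, 0 < K /\ forall x,
    ((normc (psi x))%:E * expeR (assoc_fun tau sigma (enorm x)) <= K%:E)%E.
  exists (`|fine S| + 1); split; first by rewrite ltr_pwDr.
  move=> x; apply: (@le_trans _ _ S).
    by apply: ereal_sup_ubound; exists x.
  case: S Soo => [s| |] //= _; last by rewrite leNye.
  by rewrite lee_fin (le_trans (ler_norm _))// lerDl.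
exists K => // i q x; rewrite (ger0_norm (normc_ge0 _)).
apply: (@le_trans _ _ (enorm x ^+ q * normc (psi x))).
  by rewrite ler_wpM2r ?normc_ge0// lerXn2r ?nnegrE ?sqrtr_ge0// le_norm_enorm.
have := hK x; rewrite /assoc_fun; case: ifPn => [r0|] h; last first.
  move: h; rewrite -leNgt => r0 h.
  have -> : enorm x = 0 by apply/eqP; rewrite eq_le r0 sqrtr_ge0.
  move: h; rewrite /= expR0 mule1 lee_fin => h.
  case: q => [|q]; first by rewrite expr0 mul1r Mseq0 mulr1.
  by rewrite expr0n mul0r mulr_ge0 ?(ltW K0)// ltW// Mseq_gt0.
rewrite -lee_fin in h *.
have rM0 : 0 < enorm x ^+ q / M tau q by rewrite divr_gt0 ?exprn_gt0 ?Mseq_gt0.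
have : ((normc (psi x))%:E * (enorm x ^+ q / M tau q)%:E <= K%:E)%E.
  apply: le_trans h; rewrite lee_wpmul2l ?lee_fin ?normc_ge0//.
  rewrite -[leLHS](_ : expeR (ln (enorm x ^+ q / M tau q))%:E = _); last first.
    by rewrite /= lnK.
  by rewrite lee_expeR; apply: ereal_sup_ubound; exists q.
by rewrite -EFinM !lee_fin mulrA ler_pdivrMr ?Mseq_gt0// mulrC.
Qed.

Section transform.
Variable phi : 'rV[R]_n -> R[i].
Let u x := complex.Re (phi x).
Let v x := complex.Im (phi x).
Hypotheses (du : wdominated u) (dv : wdominated v).

Lemma fourier_ctr xi : fourier phi xi =
  Complex (ctr u 0 xi + ctr v (- (pi / 2)) xi) (ctr v 0 xi - ctr u (- (pi / 2)) xi).
Proof.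
have iu b := dominated_integrable (dominated_ctr b xi du).
have iv b := dominated_integrable (dominated_ctr b xi dv).
rewrite /fourier /ctr /integralRn -RintegralD// -RintegralB//.
have E (t : n.-tuple (measurableTypeR R)) (w := 2 * pi * dotp (row_of_tuple t) xi) :
    phi (row_of_tuple t) * cis (- 2 * pi * dotp (row_of_tuple t) xi) =
    Complex (u (row_of_tuple t) * cos (0 + w) +
             v (row_of_tuple t) * cos (- (pi / 2) + w))
            (v (row_of_tuple t) * cos (0 + w) -
             u (row_of_tuple t) * cos (- (pi / 2) + w)).
  rewrite /cis (_ : - 2 * pi * _ = - w); last by rewrite /w !mulNr.
  rewrite cosN sinN /u /v.
  rewrite add0r [- _ + w]addrC cosBpihalf; case: (phi _) => a b.
  by apply/eqP; rewrite eq_complex/=; apply/andP; split; apply/eqP; ring.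
by congr Complex; apply: eq_Rintegral => t _; rewrite E.
Qed.

Lemma fourier_decays : ctr_decays sigma u -> ctr_decays sigma v ->
  decays sigma (fun xi => normc (fourier phi xi)).
Proof.
move=> cu cv tau tau0; have [C C0 hC] := cu tau tau0.
have [D D0 hD] := cv tau tau0; exists (2 * (C + D)).
  by rewrite mulr_gt0// addr_gt0.
move=> i q xi; rewrite (ger0_norm (normc_ge0 _)).
have := normc_le (fourier phi xi); rewrite fourier_ctr/= => h.
apply: le_trans (ler_wpM2l (exprn_ge0 _ (normr_ge0 _)) h) _.
have h1 := ler_wpM2l (exprn_ge0 q (normr_ge0 (xi 0 i)))
  (ler_normD (ctr u 0 xi) (ctr v (- (pi / 2)) xi)).
have h2 := ler_wpM2l (exprn_ge0 q (normr_ge0 (xi 0 i)))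
  (ler_normB (ctr v 0 xi) (ctr u (- (pi / 2)) xi)).
have := hC 0 i q xi; have := hC (- (pi / 2)) i q xi.
have := hD 0 i q xi; have := hD (- (pi / 2)) i q xi.
by move: h1 h2; rewrite !mulrDr; lra.
Qed.

(** The transforms of the real and imaginary parts are recovered from the values
    of the Fourier transform at [xi] and [- xi]. *)
Lemma ctr_decays_of_fourier : decays sigma (fun xi => normc (fourier phi xi)) ->
  ctr_decays sigma u /\ ctr_decays sigma v.
Proof.
move=> df.
have sinN0 (w : 'rV[R]_n -> R) xi : wdominated w ->
    ctr w (- (pi / 2)) (- xi) = - ctr w (- (pi / 2)) xi.
  move=> dw; rewrite ctrN opprK [LHS]ctr_phase// [in RHS]ctr_phase// !(cosN, sinN).
  by rewrite cos_pihalf sin_pihalf; ring.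
have cosN0 (w : 'rV[R]_n -> R) xi : ctr w 0 (- xi) = ctr w 0 xi.
  by rewrite ctrN oppr0.
have NxiE xi i : `|(- xi) 0 i| = `|xi 0 i| by rewrite mxE normrN.
suff H (w : 'rV[R]_n -> R) : wdominated w ->
    (forall xi, `|ctr w 0 xi| + `|ctr w (- (pi / 2)) xi| <=
       normc (fourier phi xi) + normc (fourier phi (- xi))) -> ctr_decays sigma w.
  split; apply: H => // xi.
    have := normc_ge_Re (fourier phi xi); have := normc_ge_Re (fourier phi (- xi)).
    have := normc_ge_Im (fourier phi xi); have := normc_ge_Im (fourier phi (- xi)).
    rewrite !fourier_ctr/= !cosN0 !sinN0//.
    by rewrite !ler_norml => /andP[? ?] /andP[? ?] /andP[? ?] /andP[? ?];
      case: (ger0P (ctr u 0 xi)); case: (ger0P (ctr u (- (pi / 2)) xi)); lra.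
  have := normc_ge_Re (fourier phi xi); have := normc_ge_Re (fourier phi (- xi)).
  have := normc_ge_Im (fourier phi xi); have := normc_ge_Im (fourier phi (- xi)).
  rewrite !fourier_ctr/= !cosN0 !sinN0//.
  by rewrite !ler_norml => /andP[? ?] /andP[? ?] /andP[? ?] /andP[? ?];
    case: (ger0P (ctr v 0 xi)); case: (ger0P (ctr v (- (pi / 2)) xi)); lra.
move=> dw hw tau tau0; have [C C0 hC] := df tau tau0.
exists (2 * C); first by rewrite mulr_gt0.
move=> a i q xi.
apply: le_trans (ler_wpM2l (exprn_ge0 _ (normr_ge0 _))
  (le_trans (ctr_le a xi dw) (hw xi))) _.
have := hC i q xi; have := hC i q (- xi).
rewrite NxiE !(ger0_norm (normc_ge0 _)) mulrDr; lra.
Qed.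

End transform.

End gelfand_shilov_conditions.

(** * The equivalence *)

Theorem theorem4p5 (R : realType) (n : nat) (hn : (0 < n)%N) (sigma : R)
    (hsigma : 1 < sigma) (phi : 'rV[R]_n -> R[i]) (hphi : smooth phi) :
  [<->
    gelfand_shilov sigma phi;

    forall tau : R, 0 < tau -> exists2 C : R, 0 < C &
      forall alpha beta : {ffun 'I_n -> nat},
        (sup_norm (fun x => (mpow x alpha)%:C%C * phi x)%R <=
           (C * Mseq tau sigma (mabs alpha))%:E)%E /\
        (sup_norm (mpartial beta phi) <=
           (C * Mseq tau sigma (mabs beta))%:E)%E;

    forall tau : R, 0 < tau -> exists2 C : R, 0 < C &
      forall alpha beta : {ffun 'I_n -> nat},
        (sup_norm (fun x => (mpow x alpha)%:C%C * phi x)%R <=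
           (C * Mseq tau sigma (mabs alpha))%:E)%E /\
        (sup_norm (fun xi => (mpow xi beta)%:C%C * fourier phi xi)%R <=
           (C * Mseq tau sigma (mabs beta))%:E)%E;

    forall tau : R, 0 < tau ->
      (ereal_sup (range (fun x =>
         (ComplexField.Normc.normc (phi x))%:E *
         expeR (assoc_fun tau sigma (enorm x)))) < +oo)%E /\
      (ereal_sup (range (fun xi =>
         (ComplexField.Normc.normc (fourier phi xi))%:E *
         expeR (assoc_fun tau sigma (enorm xi)))) < +oo)%E ].
Proof.
pose u x := complex.Re (phi x); pose v x := complex.Im (phi x).
have uoo : Cinfty u by move=> k; exact: (hphi k).1.
have voo : Cinfty v by move=> k; exact: (hphi k).2.
pose D (psi : 'rV[R]_n -> R[i]) :=
  decays sigma (fun x => ComplexField.Normc.normc (psi x)).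
have uvD : D phi -> [/\ decays sigma u, decays sigma v, wdominated u & wdominated v].
  move=> dphi; have du := decays_Re dphi; have dv := decays_Im dphi.
  split=> //; apply: (decays_wdominated hn _ (sigma := sigma)) => //.
    exact: Cinfty_continuous.
  exact: Cinfty_continuous.
pose zero := single (Ordinal hn) 0.
tfae.
- move=> [_ h] tau tau0; have [C C0 hC] := h tau tau0; exists C => // alpha beta.
  split; apply/sup_norm_leP => x.
    have /sup_norm_leP/(_ x) := hC alpha zero.
    rewrite mabs_single Mseq0 mulr1 mpartial_ipartial !ipartial_single/=.
    by case: (phi x).
  have /sup_norm_leP/(_ x) := hC zero beta.
  by rewrite mabs_single Mseq0 mulr1 mpow_single expr0 mul1r.
- move=> h.
  have dphi : D phi.
    apply: decays_of_monomial => tau tau0; have [C C0 hC] := h tau tau0.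
    by exists C => // alpha; exact: (hC alpha alpha).1.
  have [du dv wu wv] := uvD dphi.
  have [pu pv] : partials_bounded sigma u /\ partials_bounded sigma v.
    split=> tau tau0; have [C C0 hC] := h tau tau0; exists C => // beta x;
      have /sup_norm_leP/(_ x) := (hC beta beta).2; apply: le_trans;
      rewrite mpartial_ipartial.
      exact: (normc_ge_Re (Complex _ _)).
    exact: (normc_ge_Im (Complex _ _)).
  have cu := ctr_decays_of_partials hn hsigma uoo du pu.
  have cv := ctr_decays_of_partials hn hsigma voo dv pv.
  have mphi := monomial_of_decays hn dphi.
  have mhat := monomial_of_decays hn (fourier_decays wu wv cu cv).
  move=> tau tau0; have [C1 C10 hC1] := mphi tau tau0.
  have [C2 C20 hC2] := mhat tau tau0.
  exists (C1 + C2) => [|alpha beta]; first exact: addr_gt0.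
  have M0 p : 0 <= Mseq tau sigma p by rewrite ltW// Mseq_gt0.
  split; [apply: le_trans (hC1 alpha) _|apply: le_trans (hC2 beta) _];
    by rewrite lee_fin ler_wpM2r// ?lerDl ?lerDr ltW.
- move=> h tau tau0; split;
    (apply: assoc_bound_of_decays => //; apply: decays_of_monomial => t t0;
     have [C C0 hC] := h t t0; exists C => // alpha).
    exact: (hC alpha alpha).1.
  exact: (hC alpha alpha).2.
- move=> h; have dphi : D phi.
    by apply: decays_of_assoc_bound => tau tau0; exact: (h tau tau0).1.
  have [du dv wu wv] := uvD dphi.
  have [cu cv] : ctr_decays sigma u /\ ctr_decays sigma v.
    apply: ctr_decays_of_fourier => //; apply: decays_of_assoc_bound => tau tau0.
    exact: (h tau tau0).2.
  have pu := partials_of_ctr_decays hn hsigma uoo wu cu.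
  have pv := partials_of_ctr_decays hn hsigma voo wv cv.
  split=> // tau tau0.
  have [C1 C10 hC1] := decay_ipartial hsigma uoo du pu tau0.
  have [C2 C20 hC2] := decay_ipartial hsigma voo dv pv tau0.
  exists (C1 + C2) => [|alpha beta]; first exact: addr_gt0.
  apply/sup_norm_leP => x; rewrite normcZ; have [i hi] := max_coord x hn.
  apply: le_trans (ler_wpM2r (normc_ge0 _) (norm_mpow_le alpha hi)) _.
  apply: le_trans (ler_wpM2l (exprn_ge0 _ (normr_ge0 _)) (normc_le _)) _.
  by rewrite mpartial_ipartial/= mulrDr !mulrDl lerD.
Qed.
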